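(* All limits below are in distribution, as $N\to\infty$, for random elements of $\{0,1\}^{\mathbb{Z}}$ with the product topology. (a) Let $p\in(0,\frac12)$, and let $\eta^{iid}=(\eta^{iid}_n)_{n\in\mathbb{Z}}$ be i.i.d. Bernoulli($p$) with path encoding $S$. For $N\in\mathbb{N}$, let $(\eta^{N,iid}_n)_{n=1}^N$ have the law of $(\eta^{iid}_n)_{n=1}^N$ conditioned on $\{S_N>0\}$, extended to $\mathbb{Z}$ by cyclic repetition. Then $\eta^{N,iid}\stackrel{d}{\rightarrow}\eta^{iid}$. (b) Let $p_0,p_1\in(0,1)$ with $p_0+p_1<1$, and let $\eta^{Mar}=(\eta^{Mar}_n)_{n\in\mathbb{Z}}$ be the two-sided stationary Markov chain on $\{0,1\}$ with $\mathbf{P}(\eta^{Mar}_{n+1}=1\mid\eta^{Mar}_n=j)=p_j$, $j\in\{0,1\}$, with invariant probability measure $\nu$ and path encoding $S$. For $N\in\mathbb{N}$, let $(\eta^{N,Mar}_n)_{n=1}^N$ be the $\{0,1\}^N$-valued random variable with law characterised by \[\mathbf{E}\left(F\left((\eta^{N,Mar}_n)_{n=1}^{N}\right)\right)=\frac{\mathbf{E}\left(\nu(\eta^{Mar}_0)^{-1}F\left((\eta^{Mar}_n)_{n=1}^{N}\right)\,\middle|\,\eta^{Mar}_N=\eta^{Mar}_0,\:S_N>0\right)}{\mathbf{E}\left(\nu(\eta^{Mar}_0)^{-1}\,\middle|\,\eta^{Mar}_N=\eta^{Mar}_0,\:S_N>0\right)}\] for all $F:\{0,1\}^N\to\mathbb{R}$,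 extended to $\mathbb{Z}$ by cyclic repetition. Then $\eta^{N,Mar}\stackrel{d}{\rightarrow}\eta^{Mar}$. (c) Let $p\in(0,1)$ and $K\in\mathbb{N}$. Let $\eta$ be i.i.d. Bernoulli($p$) with path encoding $S$. For $N\in\mathbb{N}$, let $(\eta^{N,b}_n)_{n=1}^N$ have the law of $(\eta_n)_{n=1}^N$ conditioned on $\mathcal{A}_{N,K}\cap\{S_N>0\}$, where \[\mathcal{A}_{N,K}=\left\{\max_{0\leq n\leq N}\max\left\{\max_{0\leq m\leq n}(S_m-S_n),\:\max_{n\leq m\leq N}(S_m-S_N-S_n)\right\}\leq K\right\},\] extended to $\mathbb{Z}$ by cyclic repetition. Then $\eta^{N,b}\stackrel{d}{\rightarrow}\tilde\eta^{(K)}$, where $\tilde\eta^{(K)}$ is the bounded soliton configuration with parameters $p,K$ defined in the context.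
   Context: For $\eta\in\{0,1\}^{\mathbb{Z}}$, the path encoding $S:\mathbb{Z}\to\mathbb{Z}$ is given by $S_0=0$, $S_n-S_{n-1}=1-2\eta_n$ for all $n\in\mathbb{Z}$. Bounded soliton configuration $\tilde\eta^{(K)}$ (for $p\in(0,1)$). Let $P=(P(x,y))_{x,y\in\mathbb{Z}_+}$ be the transition matrix on $\mathbb{Z}_+=\{0,1,2,\dots\}$ with $P(x,x+1)=p$ for all $x\ge0$, $P(x,x-1)=1-p$ for $x\ge1$, $P(0,0)=1-p$, and all other entries $0$. Let $P^{(K)}$ be its restriction to $\{0,\dots,K\}^2$, a finite irreducible substochastic matrix; let $\lambda_K\in(0,1)$ be its Perron–Frobenius (largest magnitude) eigenvalue, and $h_K=(h_K(x))_{x\in\{0,\dots,K\}}$ the corresponding strictly positive (right) eigenvector, unique up to scaling. Define the stochastic matrix $\tilde P^{(K)}(x,y)=\frac{P^{(K)}(x,y)h_K(y)}{\lambda_Kh_K(x)}$, $x,y\in\{0,\dots,K\}$. The associated Markov chain is reversible with stationary probability measure $\tilde\pi^{(K)}_x\propto h_K(x)^2\left(\frac{p}{1-p}\right)^x$. Let $\tilde W^{(K)}=(\tilde W^{(K)}_n)_{n\in\mathbb{Z}}$ be the two-sided stationary version of this chain. Then $\tilde\eta^{(K)}=(\tilde\eta^{(K)}_n)_{n\in\mathbb{Z}}$ is the configuration whose carrier process is $\tilde W^{(K)}$, that is, $\tilde\eta^{(K)}_n=\mathbf{1}_{\{\tilde W^{(K)}_n-\tilde W^{(K)}_{n-1}=1\}}$.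 *)

(* Defs.v *)
From HB Require Import structures.
From mathcomp Require Import all_boot all_order all_algebra.
From mathcomp.real_closed Require Import complex.
From mathcomp Require Import all_classical all_reals all_analysis.

Set Implicit Arguments.
Unset Strict Implicit.
Unset Printing Implicit Defensive.

Import Order.TTheory GRing.Theory Num.Theory.
Import numFieldTopology.Exports.

Local Open Scope classical_set_scope.
Local Open Scope ring_scope.

HB.instance Definition _ (n : nat) := isPointed.Build 'I_n.+1 ord0.
HB.instance Definition _ (n : nat) := @isMeasurable.Build
  default_measure_display 'I_n.+1 discrete_measurable discrete_measurable0
  discrete_measurableC discrete_measurableU.

Section Probability.
Context {R : realType} {d : measure_display} {T : measurableType d}.
Variable P : probability T R.

Definition prob (A : set T) : R := fine (P A).

Definition cond_prob (A B : set T) : R := prob (A `&` B) / prob B.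

Definition cond_expect (f : T -> R) (B : set T) : R :=
  (\int[P]_(w in B) f w) / prob B.

Definition mutually_independent {I : choiceType} {d'}
    {E : measurableType d'} (X : I -> T -> E) : Prop :=
  forall (s : seq I) (B : I -> set E), uniq s ->
    (forall i, measurable (B i)) ->
    prob [set w | forall i, i \in s -> B i (X i w)] =
    \prod_(i <- s) prob (X i @^-1` B i).

Definition iid_bernoulli (p : R) (eta : int -> {RV P >-> bool}) : Prop :=
  mutually_independent (fun n => eta n : T -> bool) /\
  forall n, distribution P (eta n) = bernoulli_prob p :> (set bool -> \bar R).

Definition invariant_probability {E : finType} (Q : E -> E -> R)
    (pi : E -> R) : Prop :=
  [/\ forall x, 0 <= pi x, \sum_x pi x = 1 &
      forall y, \sum_x pi x * Q x y = pi y].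

(* The Markov property is required at every time n, given any finite stretch
   X_n = z 0, X_(n-1) = z 1, ..., X_(n-k) = z k of the past that has positive
   probability. *)
Definition stationary_markov_chain {E : finType} (Q : E -> E -> R)
    (pi : E -> R) (X : int -> T -> E) : Prop :=
  [/\ invariant_probability Q pi,
      forall n x, prob [set w | X n w = x] = pi x &
      forall (n : int) (k : nat) (z : nat -> E) (y : E),
        let past :=
          [set w | forall i : nat, (i <= k)%N -> X (n - i%:Z) w = z i] in
        0 < prob past -> cond_prob [set w | X (n + 1) w = y] past = Q (z 0%N) y].

End Probability.

Definition has_conditional_law {R : realType} {d d' : measure_display}
    {T : measurableType d} {T' : measurableType d'} {E : finType}
    (P' : probability T' R) (Y : T' -> E)
    (P : probability T R) (X : T -> E) (A : set T) : Prop :=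
  forall B : set E, prob P' (Y @^-1` B) = cond_prob P (X @^-1` B) A.

Definition cvg_in_distribution {R : realType} {E : topologicalType}
    {dN : nat -> measure_display} {TN : forall N, measurableType (dN N)}
    (PN : forall N, probability (TN N) R) (XN : forall N, TN N -> E)
    {d : measure_display} {T : measurableType d}
    (P : probability T R) (X : T -> E) : Prop :=
  forall f : E -> R, continuous f -> (exists M : R, forall x, `|f x| <= M) ->
    ('E_(PN N)[f \o XN N])%E @[N --> \oo] --> ('E_P[f \o X])%E.

(* The random element of {0,1}^Z whose coordinates are the X n. *)
Definition config {T : Type} (X : int -> T -> bool) :
  T -> {ptws int -> bool} := fun w n => X n w.

Definition block (N : nat) (x : int -> bool) : N.-tuple bool :=
  [tuple x (i.+1)%:Z | i < N].

Definition cyclic (N : nat) (x : int -> bool) : Prop :=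
  forall n, x (n + N%:Z) = x n.

Definition path_step (eta : int -> bool) (n : int) : int :=
  1 - (eta n : nat)%:Z *+ 2.

Definition path_encoding (eta : int -> bool) (n : int) : int :=
  match n with
  | Posz m => \sum_(1 <= k < m.+1) path_step eta k%:Z
  | Negz m => - \sum_(0 <= k < m.+1) path_step eta (- k%:Z)
  end.

Lemma path_encoding0 (eta : int -> bool) : path_encoding eta 0 = 0.
Proof. exact: big_geq. Qed.

Lemma path_encodingB (eta : int -> bool) (n : int) :
  path_encoding eta n - path_encoding eta (n - 1) =
  1 - (eta n : nat)%:Z *+ 2.
Proof.
case: n => [[|m]|m].
- rewrite path_encoding0 sub0r (_ : Posz 0 - 1 = Negz 0) //= big_nat1.
  by rewrite oppr0 opprK.
- rewrite (_ : Posz m.+1 - 1 = Posz m) /=; last by rewrite intS addrC addKr.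
  by rewrite big_nat_recr //= addrAC subrr add0r.
- rewrite (_ : Negz m - 1 = Negz m.+1); last first.
    by rewrite !NegzE -opprD [m.+2%:Z]intS addrC.
  by rewrite /= [X in _ - - X]big_nat_recr //= opprK addKr -NegzE.
Qed.

(* Maximum of f over the nonempty integer range a <= i <= b. *)
Definition max_range (a b : nat) (f : nat -> int) : int :=
  \big[Num.max/f a]_(a <= i < b.+1) f i.

Definition bounded_solitons (N K : nat) (S : int -> int) : Prop :=
  max_range 0 N (fun n =>
    Num.max (max_range 0 n (fun m => S m - S n))
            (max_range n N (fun m => S m - S N - S n))) <= K%:Z.

Section BoundedSolitonChain.
Context {R : realType}.
Implicit Types (p lam : R) (K : nat).

Definition two_state_kernel (p0 p1 : R) (j k : bool) : R :=
  let pj := if j then p1 else p0 in if k then pj else 1 - pj.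

Definition walk_kernel p (x y : nat) : R :=
  if y == x.+1 then p
  else if (x == y.+1) || ((x == 0%N) && (y == 0%N)) then 1 - p
  else 0.

Definition walk_mx p K : 'M[R]_K.+1 := \matrix_(x, y) walk_kernel p x y.

(* lam is the eigenvalue of A of largest modulus, among all complex ones, and
   h is a strictly positive right eigenvector for it. *)
Definition perron_frobenius n (A : 'M[R]_n) lam (h : 'cV[R]_n) : Prop :=
  [/\ A *m h = lam *: h, forall x, 0 < h x 0 &
      forall mu : R[i], eigenvalue (map_mx (real_complex R) A) mu ->
        `|mu| <= (`|lam|)%:C%C].

Definition doob_kernel K (A : 'M[R]_K.+1) lam (h : 'cV[R]_K.+1)
    (x y : 'I_K.+1) : R :=
  A x y * h y 0 / (lam * h x 0).

Definition soliton_weight p K (h : 'cV[R]_K.+1) (x : 'I_K.+1) : R :=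
  h x 0 ^+ 2 * (p / (1 - p)) ^+ x.

Definition soliton_measure p K (h : 'cV[R]_K.+1) (x : 'I_K.+1) : R :=
  soliton_weight p h x / \sum_y soliton_weight p h y.

End BoundedSolitonChain.

Definition carrier_config {T : Type} {K : nat} (W : int -> T -> 'I_K)
    (n : int) (w : T) : bool :=
  (W n w)%:Z - (W (n - 1) w)%:Z == 1.

(* Main.v *)
(* Call the weight of a cyclic word the product of a Markov kernel Q along its
   cyclically consecutive letters.  In all three cases the block of eta^N is the
   word of labels of a cyclic word drawn with probability proportional to its
   weight, restricted to "good" words: those with S_N > 0 in (a) and (b), and the
   closed walks of the carrier that stay at least once at 0 in (c), where Q is
   the Doob transform of the walk and the powers of lambda cancel.  Bad words
   have vanishing total weight, by a strictly superharmonic function of a tilted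
   or killed kernel.  Without the restriction the weight is invariant under
   rotation, and the words with a given window x s weigh
   path_wt Q x s * Q^n (last x s) x, which tends to the law of the stationary
   chain because Q^n (y, x) tends to pi x.
   In (c), W is the carrier of a periodic path S iff V = W + S solves
   V (n+1) = max (V n, S (n+1)) and V N = V 0 + S N; two solutions driven by the
   same S coincide as soon as both of them increase somewhere. *)

Require Import Defs.
From HB Require Import structures.
From mathcomp Require Import all_boot all_order all_algebra.
From mathcomp Require Import all_classical all_reals all_analysis.
From mathcomp Require Import measurable_realfun zify lra ring.

Set Implicit Arguments.
Unset Strict Implicit.
Unset Printing Implicit Defensive.

Import Order.TTheory GRing.Theory Num.Theory.
Import numFieldTopology.Exports numFieldNormedType.Exports.

Local Open Scope classical_set_scope.
Local Open Scope ring_scope.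

(** * Weights of cyclic words *)

(** The total weight of the cyclic words of length N is the trace of Q^N, which tends to 1, so that
    normalising constants need no asymptotics of their own. This is why (c) passes to a Doob
    transform: the walk on {0, ..., K} is only substochastic, and around a cycle the factors of [h]
    cancel. In (b) the factor 1/nu(eta_0) removes the initial law from the weight of a stationary
    path, and with eta_N = eta_0 the rest is a cyclic weight. Rotation invariance is essential
    because the window around 0 straddles both ends of the block: a rotation turns it into a prefix.
    In (a) and (b) the tilt multiplies the weight of a word by th^(-S_N) with th > 1, which does not
    decrease it on bad words, while the total tilted weight vanishes in the limit. In (c) the
    obstacle is that labels do not always determine a walk: a closed walk without a stay at 0 may
    sometimes be shifted vertically with the same labels, and it has S_N = 0. Stays are exactly the
    steps at which V increases, hence the condition under which solutions coincide. *)

Section Sequences.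
Variable E : Type.
Implicit Types (x : E) (s t : seq E).

Lemma nth_rot x0 r s i : (i < size s)%N -> (r <= size s)%N ->
  nth x0 (rot r s) i = nth x0 s ((r + i) %% size s).
Proof.
move=> lt_is le_rs; rewrite /rot nth_cat size_drop.
case: ltnP => [lt_i|le_i].
  by rewrite nth_drop modn_small //; lia.
rewrite nth_take; last by lia.
have -> : (r + i = (i - (size s - r)) + size s)%N by lia.
by rewrite modnDr modn_small //; lia.
Qed.

Lemma zip_drop (F : Type) r s (t : seq F) :
  zip (drop r s) (drop r t) = drop r (zip s t).
Proof.
by elim: r s t => [|r IHr] [|x s] [|y t] //=; rewrite ?drop0 //; case: drop.
Qed.

Lemma zip_take (F : Type) r s (t : seq F) :
  zip (take r s) (take r t) = take r (zip s t).
Proof. by elim: r s t => [|r IHr] [|x s] [|y t] //=; rewrite IHr. Qed.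

Lemma zip_rot (F : Type) r s (t : seq F) : size s = size t ->
  zip (rot r s) (rot r t) = rot r (zip s t).
Proof.
by move=> eq_st; rewrite /rot zip_cat ?size_drop ?eq_st // zip_drop zip_take.
Qed.

(** Entry i belongs to the transition into letter i, and entry 0 closes the cycle. This matches
    labels in which bit n depends on the letters at times n - 1 and n. *)
Definition cyc V (f : E -> E -> V) s := [seq f u.1 u.2 | u <- zip (rotr 1 s) s].

Lemma size_cyc V (f : E -> E -> V) s : size (cyc f s) = size s.
Proof. by rewrite size_map size_zip size_rotr minnn. Qed.

Lemma cyc_rot V (f : E -> E -> V) r s : cyc f (rot r s) = rot r (cyc f s).
Proof. by rewrite /cyc -rot_rotr zip_rot ?size_rotr // map_rot. Qed.

Lemma zip_belast V (f : E -> E -> V) x s :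
  [seq f u.1 u.2 | u <- zip (belast x s) s] = pairmap f x s.
Proof. by elim: s x => [|y s IHs] x //=; rewrite IHs. Qed.

Lemma cyc_cons V (f : E -> E -> V) x s :
  cyc f (x :: s) = f (last x s) x :: pairmap f x s.
Proof. by rewrite /cyc lastI rotr1_rcons -lastI /= zip_belast. Qed.

End Sequences.

Section CyclicWalks.
Variables (R : numDomainType) (E : finType).
Implicit Types (A Q : E -> E -> R) (g v : E -> R) (x y : E) (s t : seq E).

(** The kernel acts on functions, as on column vectors. The entry A^n (x, y) appears throughout as
    [iter n (step_op A)] applied to the indicator of y and evaluated at x. *)
Definition step_op A g x := \sum_y A x y * g y.

Definition path_wt A x s := \prod_(a <- pairmap A x s) a.

Definition cyc_wt A s := \prod_(a <- cyc A s) a.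

Lemma path_wt_cons A x y s : path_wt A x (y :: s) = A x y * path_wt A y s.
Proof. by rewrite /path_wt /= big_cons. Qed.

Lemma path_wt_cat A x s t :
  path_wt A x (s ++ t) = path_wt A x s * path_wt A (last x s) t.
Proof. by rewrite /path_wt pairmap_cat big_cat. Qed.

Lemma path_wt_rcons A x s y :
  path_wt A x (rcons s y) = path_wt A x s * A (last x s) y.
Proof. by rewrite -cats1 path_wt_cat path_wt_cons /path_wt big_nil mulr1. Qed.

Lemma cyc_wt_cons A x s : cyc_wt A (x :: s) = A (last x s) x * path_wt A x s.
Proof. by rewrite /cyc_wt cyc_cons big_cons. Qed.

Lemma cyc_wt_rot A r s : cyc_wt A (rot r s) = cyc_wt A s.
Proof. by rewrite /cyc_wt cyc_rot; apply: perm_big; rewrite perm_rot. Qed.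

Lemma path_wt_ge0 A x s : (forall x y, 0 <= A x y) -> 0 <= path_wt A x s.
Proof.
move=> A_ge0; elim: s x => [|y s IHs] x; first by rewrite /path_wt big_nil.
by rewrite path_wt_cons mulr_ge0.
Qed.

Lemma cyc_wt_ge0 A s : (forall x y, 0 <= A x y) -> 0 <= cyc_wt A s.
Proof.
by move=> A_ge0; rewrite /cyc_wt big_map prodr_ge0.
Qed.

Lemma big_tuple0 (F : seq E -> R) : \sum_(t : 0.-tuple E) F t = F [::].
Proof.
by rewrite (big_pred1 [tuple]) // => t; rewrite [t]tuple0 /= eqxx.
Qed.

Lemma big_tuple_cons n (F : seq E -> R) :
  \sum_(t : n.+1.-tuple E) F t = \sum_x \sum_(t : n.-tuple E) F (x :: t).
Proof.
rewrite pair_big /=.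
rewrite (reindex (fun u : E * n.-tuple E => [tuple of u.1 :: u.2])) //=.
exists (fun t : n.+1.-tuple E => (thead t, [tuple of behead t])) => [[x t]|t] _ /=.
  by congr (_, _); apply: val_inj.
by rewrite -tuple_eta.
Qed.

Lemma sum_path_wt A g n x :
  \sum_(t : n.-tuple E) path_wt A x t * g (last x t) = iter n (step_op A) g x.
Proof.
elim: n x => [|n IHn] x.
  by rewrite (big_tuple0 (fun t => path_wt A x t * g (last x t))) /path_wt big_nil mul1r.
rewrite (big_tuple_cons n (fun t => path_wt A x t * g (last x t))) iterS.
apply: eq_bigr => y _; rewrite -IHn big_distrr /=.
by apply: eq_bigr => t _; rewrite path_wt_cons mulrA.
Qed.

Lemma sum_prefix n z (F : seq E -> R) :
  \sum_(t : (size z + n).-tuple E | take (size z) t == z) F t =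
  \sum_(t : n.-tuple E) F (z ++ t).
Proof.
elim: z F => [|x z IHz] F /=; first by apply: eq_bigl => t; rewrite take0.
rewrite big_mkcond (big_tuple_cons (size z + n)
  (fun t => if take (size z).+1 t == x :: z then F t else 0)) (bigD1 x) //=.
rewrite [X in _ + X]big1 ?addr0 => [|y neq_yx]; last first.
  by apply: big1 => t _; rewrite eqseq_cons (negbTE neq_yx).
rewrite -(IHz (fun t => F (x :: t))) [RHS]big_mkcond; apply: eq_bigr => t _.
by rewrite eqseq_cons eqxx.
Qed.

(** The n free letters and the closing transition make n + 1 steps from the end of the prefix back
    to x. *)
Lemma sum_cyc_wt_prefix A n x s :
  \sum_(t : (size (x :: s) + n).-tuple E | take (size (x :: s)) t == x :: s)
    cyc_wt A t =
  path_wt A x s * iter n.+1 (step_op A) (fun y => (y == x)%:R) (last x s).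
Proof.
rewrite sum_prefix iterSr -sum_path_wt big_distrr /=; apply: eq_bigr => t _.
rewrite cyc_wt_cons path_wt_cat last_cat mulrC -mulrA; congr (_ * (_ * _)).
rewrite /step_op (bigD1 x) //= eqxx mulr1 big1 ?addr0 // => y /negbTE->.
by rewrite mulr0.
Qed.

End CyclicWalks.

(** * Ergodicity and concentration on good words *)

(** The explicit bound 1 / (1 + sum of the 1 / F i) replaces a minimum, so [I] may be empty; the
    summand 1 yields e <= 1. *)
Lemma finite_lower_bound (R : realFieldType) (I : finType) (F : I -> R) :
  (forall i, 0 < F i) -> exists2 e : R, 0 < e <= 1 & forall i, e <= F i.
Proof.
move=> F_gt0; exists (1 + \sum_i (F i)^-1)^-1 => [|i].
  have ge1 : 1 <= 1 + \sum_i (F i)^-1.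
    by rewrite lerDl sumr_ge0 // => i _; rewrite invr_ge0 ltW.
  by rewrite invr_gt0 (lt_le_trans ltr01 ge1) invf_le1 // (lt_le_trans ltr01).
rewrite -[leRHS]invrK lef_pV2 ?posrE ?invr_gt0 //; last first.
  by rewrite ltr_pwDl // sumr_ge0 // => j _; rewrite invr_ge0 ltW.
rewrite (bigD1 i) //= addrCA lerDl addr_ge0 // sumr_ge0 // => j _.
by rewrite invr_ge0 ltW.
Qed.

Lemma cvg_expr_divn (R : realType) (r : R) m : 0 <= r < 1 -> (0 < m)%N ->
  r ^+ (n %/ m)%N @[n --> \oo] --> (0 : R).
Proof.
move=> /andP[r_ge0 r_lt1] m_gt0.
apply: (@cvg_comp _ _ _ (fun n => (n %/ m)%N) (fun n => r ^+ n) _ \oo).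
  move=> A [k _ Ak]; exists (k * m)%N => // n /= le_n; apply: Ak => /=.
  by rewrite leq_divRL.
by apply: cvg_expr; rewrite ger0_norm.
Qed.

Section StepOperator.
Variables (R : realType) (E : finType).
Implicit Types (A Q : E -> E -> R) (g v pi : E -> R) (x y : E).

Lemma iter_step_lin A n g x : iter n (step_op A) g x =
  \sum_y iter n (step_op A) (fun u => (u == y)%:R) x * g y.
Proof.
elim: n x => [|n IHn] x /=.
  rewrite (bigD1 x) //= eqxx mul1r big1 ?addr0 // => y.
  by rewrite eq_sym => /negbTE->; rewrite mul0r.
under [RHS]eq_bigr do rewrite /step_op big_distrl.
rewrite exchange_big; apply: eq_bigr => y _; rewrite IHn big_distrr /=.
by apply: eq_bigr => z _; rewrite mulrA.
Qed.

Lemma iter_step_ge0 A n g x : (forall x y, 0 <= A x y) -> (forall x, 0 <= g x) ->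
  0 <= iter n (step_op A) g x.
Proof.
move=> A_ge0 g_ge0; elim: n x => //= n IHn x.
by apply: sumr_ge0 => y _; rewrite mulr_ge0.
Qed.

Lemma iter_step_le A n g g' x : (forall x y, 0 <= A x y) ->
  (forall x, g x <= g' x) ->
  iter n (step_op A) g x <= iter n (step_op A) g' x.
Proof.
move=> A_ge0 le_gg'; elim: n x => //= n IHn x.
by apply: ler_sum => y _; rewrite ler_wpM2l.
Qed.

Lemma iter_stepZ A n c g x :
  iter n (step_op A) (fun y => c * g y) x = c * iter n (step_op A) g x.
Proof.
rewrite iter_step_lin [in RHS]iter_step_lin big_distrr /=.
by apply: eq_bigr => y _; rewrite mulrCA.
Qed.

Lemma iter_step1 Q n x : (forall x, \sum_y Q x y = 1) ->
  iter n (step_op Q) (fun=> 1) x = 1.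
Proof.
move=> Q1; elim: n x => //= n IHn x.
by rewrite /step_op -[RHS](Q1 x); apply: eq_bigr => y _; rewrite IHn mulr1.
Qed.

Lemma iter_step_pi Q pi n g : invariant_probability Q pi ->
  \sum_x pi x * iter n (step_op Q) g x = \sum_x pi x * g x.
Proof.
move=> [_ _ piQ]; elim: n => //= n <-; under eq_bigr do rewrite big_distrr /=.
rewrite exchange_big; apply: eq_bigr => y _; rewrite -[in RHS](piQ y) big_distrl.
by apply: eq_bigr => x _; rewrite mulrA.
Qed.

(* Doeblin's argument: Q^m dominates e pi, and functions of zero pi-mean do not
   see the term e pi. *)
Lemma iter_step_cvg Q pi m g x :
  (forall x y, 0 <= Q x y) -> (forall x, \sum_y Q x y = 1) ->
  invariant_probability Q pi -> (0 < m)%N ->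
  (forall x y, 0 < iter m (step_op Q) (fun u => (u == y)%:R) x) ->
  iter n (step_op Q) g x @[n --> \oo] --> \sum_y pi y * g y.
Proof.
move=> Q_ge0 Q1 piQ m_gt0 Qm_gt0; have [pi_ge0 pi1 _] := piQ.
set c := \sum_y _; pose f y := g y - c.
have fE n y : iter n (step_op Q) g y = c + iter n (step_op Q) f y.
  rewrite [RHS]addrC -[c in RHS]mulr1 -(iter_step1 n y Q1) -iter_stepZ.
  rewrite iter_step_lin [X in X + _]iter_step_lin [X in _ + X]iter_step_lin.
  rewrite -big_split; apply: eq_bigr => z _ /=.
  by rewrite -mulrDr mulr1 subrK.
have f0 n : \sum_y pi y * iter n (step_op Q) f y = 0.
  rewrite iter_step_pi // /f; under eq_bigr do rewrite mulrBr.
  by rewrite sumrB -big_distrl /= pi1 mul1r subrr.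
(* The Doeblin constant bounds every entry of Q^m from below; as pi z <= 1, also e pi z <= Q^m (y,
   z). *)
have [e /andP[e_gt0 e_le1] le_eQ] :=
  finite_lower_bound (fun u : E * E => Qm_gt0 u.1 u.2).
have pi_le1 y : pi y <= 1.
  by rewrite -pi1 (bigD1 y) //= lerDl sumr_ge0.
have contr n (B : R) : (forall y, `|iter n (step_op Q) f y| <= B) ->
    forall y, `|iter (m + n) (step_op Q) f y| <= (1 - e) * B.
  move=> le_fB y; rewrite iterD iter_step_lin.
  set f' := iter n _ f in le_fB *.
  have -> : \sum_z iter m (step_op Q) (fun u => (u == z)%:R) y * f' z =
      \sum_z (iter m (step_op Q) (fun u => (u == z)%:R) y - e * pi z) * f' z.
    under [RHS]eq_bigr do rewrite mulrBl -mulrA.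
    by rewrite sumrB -big_distrr /= f0 mulr0 subr0.
  apply: le_trans (ler_norm_sum _ _ _) _.
  apply: le_trans (_ : \sum_z
     (iter m (step_op Q) (fun u => (u == z)%:R) y - e * pi z) * B <= _).
    apply: ler_sum => z _; rewrite normrM ger0_norm; last first.
      by rewrite subr_ge0 (le_trans _ (le_eQ (y, z))) // ler_piMr // ltW.
    rewrite ler_wpM2l // subr_ge0 (le_trans _ (le_eQ (y, z))) //.
    by rewrite ler_piMr // ltW.
  rewrite -big_distrl /= sumrB -big_distrr /= pi1 mulr1.
  under eq_bigr do rewrite -[iter m _ _ _]mulr1.
  by rewrite -(iter_step_lin Q m (fun=> 1)) iter_step1.
have B_ge y : `|f y| <= \sum_z `|f z|.
  by rewrite (bigD1 y) //= lerDl sumr_ge0.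
(* Each of the n / m full blocks contracts by 1 - e, and the n mod m remaining steps are averages,
   which do not raise the bound. The sum of the [|f z|] stands in for the supremum norm. *)
have bound n y : `|iter n (step_op Q) f y| <=
    (1 - e) ^+ (n %/ m) * \sum_z `|f z|.
  rewrite {1}(divn_eq n m) mulnC; elim: (n %/ m)%N y => [|q IHq] y.
    rewrite muln0 add0n mul1r iter_step_lin.
    apply: le_trans (ler_norm_sum _ _ _) _.
    apply: le_trans (_ : \sum_z iter (n %% m) (step_op Q)
       (fun u => (u == z)%:R) y * (1 * \sum_z `|f z|) <= _).
      apply: ler_sum => z _; rewrite normrM ger0_norm ?mul1r.
        by rewrite ler_wpM2l // iter_step_ge0 // => u; rewrite ler0n.
      by rewrite iter_step_ge0 // => u; rewrite ler0n.
    under eq_bigr do rewrite mulrA.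
    by rewrite -big_distrl /= -(iter_step_lin Q _ (fun=> 1)) iter_step1 ?mul1r.
  by rewrite exprS -mulrA mulnS -addnA; apply: contr.
have -> : (fun n => iter n (step_op Q) g x) = fun n => c + iter n (step_op Q) f x.
  by apply/funext => n; rewrite fE.
rewrite -[X in _ --> X]addr0; apply: cvgD; first exact: cvg_cst.
apply/norm_cvg0P; apply: squeeze_cvgr (cvg_cst 0) _; last first.
  rewrite -(mul0r (\sum_z `|f z|)); apply: cvgMr_tmp.
  by apply: (@cvg_expr_divn R (1 - e) m) => //; lra.
by near=> n; rewrite normr_ge0 bound.
Unshelve. all: by end_near.
Qed.


(** On a finite space a strict inequality A v < v is uniform, A v <= (1 - e) v, so A^N v decays
    geometrically. Comparing 1 with v / b, where b is a lower bound of v, the row sums of A^N decay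
    too, and they dominate its trace. *)
Lemma sum_cyc_wt_superharmonic A v :
  (forall x y, 0 <= A x y) -> (forall x, 0 < v x) ->
  (forall x, step_op A v x < v x) ->
  \sum_(t : N.-tuple E) cyc_wt A t @[N --> \oo] --> (0 : R).
Proof.
move=> A_ge0 v_gt0 Av.
have [e /andP[e_gt0 e_le1] le_e] :
    exists2 e : R, 0 < e <= 1 & forall x, e <= 1 - step_op A v x / v x.
  by apply: finite_lower_bound => x; rewrite subr_gt0 ltr_pdivrMr ?mul1r.
have [b /andP[b_gt0 _] le_bv] := finite_lower_bound v_gt0.
have iter_le n x : iter n (step_op A) v x <= (1 - e) ^+ n * v x.
  elim: n x => [|n IHn] x; first by rewrite mul1r.
  rewrite iterSr; apply: le_trans (_ : iter n (step_op A)
    (fun y => (1 - e) * v y) x <= _).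
    apply: iter_step_le => // y; rewrite -ler_pdivrMr //.
    by have := le_e y; lra.
  by rewrite iter_stepZ exprS -mulrA ler_wpM2l //; lra.
have bound n : \sum_(t : n.+1.-tuple E) cyc_wt A t <=
    (1 - e) ^+ n.+1 * (b^-1 * \sum_x v x).
  rewrite mulrA mulrC big_distrl /=.
  (* The cyclic weight of a word is its path weight started from its own last letter, one of the
     nonnegative terms of the sum over all starting points. *)
  apply: le_trans (_ : \sum_x \sum_(t : n.+1.-tuple E) path_wt A x t <= _).
    rewrite exchange_big; apply: ler_sum => t _; case/tupleP: t => x t.
    rewrite (bigD1 (last x t)) //= cyc_wt_cons -path_wt_cons lerDl sumr_ge0 //.
    by move=> y _; apply: path_wt_ge0.
  apply: ler_sum => x _.
  under eq_bigr => t _ do rewrite -[path_wt A x t]mulr1.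
  rewrite (sum_path_wt A (fun=> 1)).
  apply: le_trans (_ : iter n.+1 (step_op A) (fun y => b^-1 * v y) x <= _).
    by apply: iter_step_le => // y; rewrite ler_pdivlMl ?mulr1.
  rewrite iter_stepZ [leRHS]mulrA [leRHS]mulrC ler_pM2l ?invr_gt0 //.
  by rewrite [leRHS]mulrC.
apply: squeeze_cvgr (cvg_cst 0) _; last first.
  rewrite -(mul0r (b^-1 * \sum_x v x)); apply: cvgMr_tmp.
  by apply: (@cvg_expr R (1 - e)); rewrite ger0_norm; lra.
near=> n; have n_gt0 : (0 < n)%N by near: n; exact: nbhs_infty_gt.
rewrite -(prednK n_gt0) bound andbT sumr_ge0 // => t _.
exact: cyc_wt_ge0.
Unshelve. all: by end_near.
Qed.

(** The probability that the stationary chain spells [z] on a given window; the empty word gets the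
    empty product. *)
Definition chain_wt Q pi (z : seq E) : R :=
  if z is x :: s then pi x * path_wt Q x s else 1.

Section Ergodic.
Variables (Q : E -> E -> R) (pi : E -> R) (m : nat).
Hypotheses (Q_ge0 : forall x y, 0 <= Q x y) (Q1 : forall x, \sum_y Q x y = 1).
Hypotheses (piQ : invariant_probability Q pi) (m_gt0 : (0 < m)%N).
Hypothesis Qm_gt0 :
  forall x y, 0 < iter m (step_op Q) (fun u => (u == y)%:R) x.

Lemma cvg_sum_cyc_wt_prefix x s :
  \sum_(t : N.-tuple E | take (size (x :: s)) t == x :: s) cyc_wt Q t
    @[N --> \oo] --> chain_wt Q pi (x :: s).
Proof.
rewrite -(cvg_shiftn (size (x :: s))) /=.
under eq_fun do rewrite addnC sum_cyc_wt_prefix mulrC.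
apply: cvgMr_tmp; rewrite (cvg_shiftS (fun n => iter n _ _ _)).
rewrite (_ : pi x = \sum_y pi y * (y == x)%:R); first by apply: (@iter_step_cvg _ _ m).
by rewrite (bigD1 x) //= eqxx mulr1 big1 ?addr0 // => y /negbTE->; rewrite mulr0.
Qed.

Lemma cvg_sum_cyc_wt_take M (G : pred (seq E)) : (0 < M)%N ->
  \sum_(t : N.-tuple E | G (take M t)) cyc_wt Q t @[N --> \oo] -->
  \sum_(z : M.-tuple E | G z) chain_wt Q pi z.
Proof.
move=> M_gt0.
apply: (@cvg_trans _ ((fun N => \sum_(z : M.-tuple E | G z)
    \sum_(t : N.-tuple E | take (size z) t == z) cyc_wt Q t) @ \oo)).
  apply: near_eq_cvg; near=> N.
  have le_MN : (M <= N)%N by near: N; exact: nbhs_infty_ge.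
  have size_tk (t : N.-tuple E) : size (take M t) == M.
    by rewrite size_takel // size_tuple.
  rewrite (partition_big (fun t => Tuple (size_tk t)) (fun z => G z)) //.
  apply: eq_bigr => z Gz; apply: eq_bigl => t.
  rewrite size_tuple -val_eqE /=.
  by case: eqP => [->|]; rewrite ?Gz ?andbF.
apply: cvg_big => [|z _]; first exact: add_continuous.
case: z => -[|x s] size_z; first by exfalso; move/eqP: (size_z) M_gt0 => /= <-.
exact: cvg_sum_cyc_wt_prefix.
Unshelve. all: by end_near.
Qed.

(** Only the sum over all words has to be rotation invariant. The sum over good words differs from
    it by a part of the vanishing bad sum, so [good] may be any predicate and the rotation may
    depend on N. *)
Lemma cvg_good_walks M (G : pred (seq E)) (r : nat -> nat)
    (good : forall N, pred (N.-tuple E)) : (0 < M)%N ->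
  \sum_(t : N.-tuple E | ~~ good N t) cyc_wt Q t @[N --> \oo] --> (0 : R) ->
  \sum_(t : N.-tuple E | good N t && G (take M (rot (r N) t))) cyc_wt Q t
    @[N --> \oo] --> \sum_(z : M.-tuple E | G z) chain_wt Q pi z.
Proof.
move=> M_gt0 bad0.
have rotE N : \sum_(t : N.-tuple E | G (take M (rot (r N) t))) cyc_wt Q t =
    \sum_(t : N.-tuple E | G (take M t)) cyc_wt Q t.
  rewrite [RHS](reindex (fun t : N.-tuple E => [tuple of rot (r N) t])) /=.
    by apply: eq_bigr => t _; rewrite cyc_wt_rot.
  exists (fun t : N.-tuple E => [tuple of rotr (r N) t]) => t _.
    by apply: val_inj; rewrite /= rotK.
  by apply: val_inj; rewrite /= rotrK.
pose a N := \sum_(t : N.-tuple E | G (take M t)) cyc_wt Q t.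
pose b N := \sum_(t : N.-tuple E | ~~ good N t && G (take M (rot (r N) t)))
  cyc_wt Q t.
have -> : (fun N => \sum_(t : N.-tuple E | good N t && G (take M (rot (r N) t)))
    cyc_wt Q t) = fun N => a N - b N.
  apply/funext => N; apply/esym/eqP; rewrite subr_eq /a -rotE.
  rewrite (bigID (fun t => good N t)) /=; apply/eqP.
  by congr (_ + _); apply: eq_bigl => t; rewrite andbC.
rewrite -[X in _ --> X]subr0; apply: cvgB; first exact: cvg_sum_cyc_wt_take.
apply: squeeze_cvgr (cvg_cst 0) bad0; near=> N.
rewrite /b sumr_ge0 => [/=|t _]; last exact: cyc_wt_ge0.
rewrite [leRHS](bigID (fun t : N.-tuple E => G (take M (rot (r N) t)))) /= lerDl.
by rewrite sumr_ge0 // => t _; exact: cyc_wt_ge0.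
Unshelve. all: by end_near.
Qed.

Lemma cvg_good_walk_ratio M (G : pred (seq E)) (r : nat -> nat)
    (good : forall N, pred (N.-tuple E)) : (0 < M)%N ->
  \sum_(t : N.-tuple E | ~~ good N t) cyc_wt Q t @[N --> \oo] --> (0 : R) ->
  (\sum_(t : N.-tuple E | good N t && G (take M (rot (r N) t))) cyc_wt Q t) /
    (\sum_(t : N.-tuple E | good N t) cyc_wt Q t)
    @[N --> \oo] --> \sum_(z : M.-tuple E | G z) chain_wt Q pi z.
Proof.
move=> M_gt0 bad0; rewrite -[X in _ --> X]divr1.
apply: cvgM; first exact: cvg_good_walks.
apply: cvgV; first exact: oner_neq0.
(* The denominator is the case of the sure event on windows of length 1, with limit the total mass
   of [pi]. *)
have := @cvg_good_walks 1 xpredT (fun=> 0%N) _ isT bad0.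
under eq_fun do under eq_bigl do rewrite andbT.
congr (_ --> _).
rewrite (big_tuple_cons 0 (chain_wt Q pi)).
have [_ <- _] := piQ; apply: eq_bigr => x _.
by rewrite (big_tuple0 (fun t => chain_wt Q pi (x :: t))) /= /path_wt big_nil mulr1.
Unshelve. all: by end_near.
Qed.

End Ergodic.

End StepOperator.

(** * Convergence in distribution from finite windows *)

Definition truncate (k : nat) (x : int -> bool) : {ptws int -> bool} :=
  fun n => (`|n| <= k)%N && x n.

(** The truncation of y at level k tends to x as y tends to x and k to infinity jointly, so the
    estimate holds near each x for all large k. Compactness of the product space makes the level
    uniform. *)
Lemma uniform_truncate (R : realType) (f : {ptws int -> bool} -> R) (e : R) :
  continuous f -> 0 < e ->
  \forall k \near \oo, forall x, `|f x - f (truncate k x)| < e.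
Proof.
move=> f_cont e_gt0.
have cpt : compact [set: {ptws int -> bool}].
  rewrite (_ : setT = [set g : {ptws int -> bool} | forall i, [set: bool] (g i)]).
    exact: (tychonoff (fun=> bool_compact)).
  by apply/seteqP; split.
have /compact_near_coveringP cov := cpt.
have := cov nat \oo (fun k x => `|f x - f (truncate k x)| < e) _.
move=> near_k; suff h : \forall k \near \oo,
    [set: {ptws int -> bool}] `<=` (fun x => `|f x - f (truncate k x)| < e).
  by apply: filterS h => k h x; exact: h.
apply: near_k => x _.
have trunc_cvg : truncate u.2 u.1 @[u --> (nbhs x, \oo)] --> x.
  apply/cvg_sup => i A; rewrite nbhsE => -[_ [[B oB <-] Bx] sBA].
  have near_i : \forall y \near x, y i = x i.
    apply: (@proj_continuous int (fun=> bool) i x [set x i]).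
    exact: discrete_set1.
  exists ([set y | y i = x i], [set k | (`|i| <= k)%N]) => /=.
    by split => //; exact: nbhs_infty_ge.
  move=> [y k] /= [yi le_ik]; apply: sBA => /=.
  by rewrite /truncate le_ik yi.
have near_f : \forall y \near x, `|f y - f x| < e / 2.
  have /cvgrPdistC_lt := f_cont x.
  by apply; rewrite divr_gt0.
have near_x : \forall y \near x & k \near \oo, `|f y - f x| < e / 2.
  exists ([set y | `|f y - f x| < e / 2], setT) => /=.
    by split => //; exact: filterT.
  by move=> [y k] [].
apply: filterS (filterI near_x (trunc_cvg _ near_f)) => -[y k] [/= near_y near_t].
by rewrite (splitr e) -(subrKA (f x)) (le_lt_trans (ler_normD _ _)) ?ltrD // distrC.
Qed.

Section FiniteValued.
Context {R : realType} {d : measure_display} {T : measurableType d}.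
Variables (P : probability T R) (F : finType) (Y : T -> F).
Hypothesis mY : forall y, measurable (Y @^-1` [set y]).

Lemma measurable_preimage_finite (B : set F) : measurable (Y @^-1` B).
Proof.
rewrite (_ : Y @^-1` B = \bigcup_(y in B) (Y @^-1` [set y])).
  by apply: fin_bigcup_measurable => // ; exact: finite_finset.
apply/seteqP; split => [w Bw|w [y By /= Yw]]; first by exists (Y w).
by rewrite /= Yw.
Qed.

Lemma bounded_integrable (D : set T) (f : T -> R) (M : R) : measurable D ->
  measurable_fun [set: T] f -> (forall w, `|f w| <= M) ->
  P.-integrable D (EFin \o f).
Proof.
move=> mD mf leM; apply: measurable_bounded_integrable => //.
- by rewrite (le_lt_trans (probability_le1 P mD)) ?ltry.
- exact: measurable_funTS.
exists M; split; first exact: num_real.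
by move=> M' ltM w _; exact: le_trans (leM w) (ltW ltM).
Qed.

Lemma measurable_finite_comp (g : F -> R) : measurable_fun [set: T] (g \o Y).
Proof.
by move=> _ B mB; rewrite setTI; exact: (measurable_preimage_finite (g @^-1` B)).
Qed.

Lemma Rintegral_finite (D : set T) (g : F -> R) : measurable D ->
  \int[P]_(w in D) g (Y w) = \sum_y g y * prob P (D `&` Y @^-1` [set y]).
Proof.
move=> mD.
have int_g (h : F -> R) : P.-integrable D (EFin \o (h \o Y)).
  apply: (@bounded_integrable _ _ (\sum_y `|h y|)) => //.
    exact: measurable_finite_comp.
  by move=> w /=; rewrite (bigD1 (Y w)) //= lerDl sumr_ge0.
(* Induction over a duplicate-free list of values, splitting off one indicator at a time. *)
have split_s (s : seq F) : uniq s ->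
    \int[P]_(w in D) ((Y w \in s)%:R * g (Y w)) =
    \sum_(y <- s) g y * prob P (D `&` Y @^-1` [set y]).
  elim: s => [_|y s IHs /= /andP[ys us]].
    rewrite big_nil; under eq_Rintegral do rewrite mul0r.
    by rewrite Rintegral_cst // mul0r.
  rewrite big_cons -IHs //.
  transitivity (\int[P]_(w in D) (g y * \1_(Y @^-1` [set y]) w +
                                 (Y w \in s)%:R * g (Y w))).
    apply: eq_Rintegral => w _; rewrite in_cons indicE.
    have [eq_y|neq_y] /= := eqVneq (Y w) y.
      rewrite mem_set //= eq_y (negbTE ys) /=; ring.
    by rewrite memNset ?mulr0 ?add0r // => /eqP; rewrite (negbTE neq_y).
  rewrite RintegralD //; last exact: (int_g (fun z => (z \in s)%:R * g z)).
    congr (_ + _); rewrite RintegralZl //; last first.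
      have := int_g (fun z => (z == y)%:R); congr (integrable _ _ _).
      by apply/funext => w /=; rewrite indicE; congr ((nat_of_bool _)%:R%:E);
        apply/eqP/idP => [?|/set_mem //]; exact/mem_set.
    by rewrite /Rintegral integral_indic // setIC.
  have := int_g (fun z => g y * (z == y)%:R); congr (integrable _ _ _).
  by apply/funext => w /=; rewrite indicE; congr ((_ * (nat_of_bool _)%:R)%:E);
    apply/eqP/idP => [?|/set_mem //]; exact/mem_set.
rewrite -(split_s (index_enum F)) ?index_enum_uniq //.
by apply: eq_Rintegral => w _; rewrite mem_index_enum mul1r.
Qed.

Lemma expectation_finite (g : F -> R) :
  ('E_P[g \o Y])%E = (\sum_y g y * prob P (Y @^-1` [set y]))%:E.
Proof.
rewrite unlock; under [in RHS]eq_bigr do rewrite -(setTI (Y @^-1` _)).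
rewrite -Rintegral_finite //.
rewrite fineK //; apply: integrable_fin_num => //.
apply: (@bounded_integrable _ _ (\sum_y `|g y|)) => //.
  exact: measurable_finite_comp.
by move=> w /=; rewrite (bigD1 (Y w)) //= lerDl sumr_ge0.
Qed.

Lemma prob_finite (B : {pred F}) :
  prob P (Y @^-1` [set` B]) = \sum_(y in B) prob P (Y @^-1` [set y]).
Proof.
have := expectation_finite (fun y => (y \in B)%:R).
rewrite (_ : _ \o _ = \1_(Y @^-1` [set` B])); last first.
  apply/funext => w; rewrite indicE /=; congr ((nat_of_bool _)%:R).
  by apply/idP/idP => [Bw|/set_mem //]; exact/mem_set.
rewrite expectation_indic ?/prob; last exact: measurable_preimage_finite.
move=> ->; rewrite /= [RHS]big_mkcond /=; apply: eq_bigr => y _.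
by case: (y \in B); rewrite ?mul1r ?mul0r.
Qed.

End FiniteValued.

Definition window (T E : Type) (X : int -> T -> E) (a : int) (M : nat) (w : T) :
  M.-tuple E := [tuple X (a + i%:Z) w | i < M].

Lemma nth_window (T E : Type) (X : int -> T -> E) a M w x0 i : (i < M)%N ->
  nth x0 (window X a M w) i = X (a + i%:Z) w.
Proof.
by move=> lt_iM; rewrite -[i]/(nat_of_ord (Ordinal lt_iM)) -tnth_nth tnth_mktuple.
Qed.

Lemma measurable_window d (T : measurableType d) (E : finType)
    (X : int -> T -> E) a M z :
  (forall n x, measurable (X n @^-1` [set x])) ->
  measurable (window X a M @^-1` [set z]).
Proof.
move=> mX; rewrite (_ : _ @^-1` _ =
  \bigcap_(i in [set: 'I_M]) (X (a + i%:Z) @^-1` [set tnth z i])).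
  by apply: fin_bigcap_measurable => //; exact: finite_finset.
apply/seteqP; split => [w <- i _|w Xw] /=; first by rewrite tnth_mktuple.
by apply: eq_from_tnth => i; rewrite tnth_mktuple Xw.
Qed.

Section Windows.
Variable R : realType.

(** Rebuilds a truncated configuration from its window on [-k, k]. The guard makes n + k
    nonnegative, so the absolute value only converts it to a natural number. *)
Definition untruncate k (z : (k.*2.+1).-tuple bool) : {ptws int -> bool} :=
  fun n => (`|n| <= k)%N && nth false z `|n + k%:Z|.

Lemma truncate_window T (X : int -> T -> bool) k w :
  truncate k (config X w) = untruncate (window X (- k%:Z) k.*2.+1 w).
Proof.
apply/funext => n; rewrite /truncate /untruncate /config.
case: leqP => //= le_nk; rewrite nth_window; last by lia.
by congr X; lia.
Qed.

Section OneVariable.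
Context {d : measure_display} {T : measurableType d}.
Variables (P : probability T R) (X : int -> T -> bool).
Hypothesis mX : forall n b, measurable (X n @^-1` [set b]).
Variables (f : {ptws int -> bool} -> R) (M : R).
Hypotheses (f_cont : continuous f) (f_le : forall x, `|f x| <= M).

Lemma measurable_truncate k :
  measurable_fun [set: T] (fun w => f (truncate k (config X w))).
Proof.
under eq_fun do rewrite truncate_window.
by apply: (measurable_finite_comp _ (f \o @untruncate k)) => z;
  exact: measurable_window.
Qed.

(** A pointwise limit of functions of finitely many coordinates; no sigma-algebra on the space of
    configurations is involved. *)
Lemma measurable_config : measurable_fun [set: T] (f \o config X).
Proof.
apply: (@measurable_fun_cvg _ _ _ _ (fun k w => f (truncate k (config X w)))).
  exact: measurable_truncate.
move=> w _; apply/cvgrPdist_lt => e e_gt0.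
by apply: filterS (uniform_truncate f_cont e_gt0) => k; apply.
Qed.

Lemma expectation_config : ('E_P[f \o config X])%E =
  (\int[P]_w f (config X w))%:E.
Proof.
rewrite unlock fineK //; apply: integrable_fin_num => //.
by apply: (@bounded_integrable _ _ _ P _ _ M) => //;
  exact: measurable_config.
Qed.

Lemma expectation_truncate k (e : R) : (forall x, `|f x - f (truncate k x)| <= e) ->
  `|\int[P]_w f (config X w) - \sum_z f (untruncate z) *
     prob P (window X (- k%:Z) k.*2.+1 @^-1` [set z])| <= e.
Proof.
move=> le_e.
have := @Rintegral_finite _ _ _ P _ (window X (- k%:Z) k.*2.+1)
  (fun z => measurable_window (- k%:Z) z mX) setT (f \o @untruncate k) measurableT.
under [X in _ = X -> _]eq_bigr do rewrite setTI.
move=> <-; under [X in _ - X]eq_Rintegral do rewrite /= -truncate_window.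
have int1 : P.-integrable setT (EFin \o (fun w => f (config X w))).
  apply: (@bounded_integrable _ _ _ P _ _ M) => //.
  exact: measurable_config.
have int2 : P.-integrable setT (EFin \o (fun w => f (truncate k (config X w)))).
  apply: (@bounded_integrable _ _ _ P _ _ M) => //.
  exact: measurable_truncate.
have int12 : P.-integrable setT
    (EFin \o (fun w => f (config X w) - f (truncate k (config X w)))).
  apply: (@bounded_integrable _ _ _ P _ _ e) => //.
  by apply: measurable_funB; [exact: measurable_config | exact: measurable_truncate].
rewrite -RintegralB //; apply: le_trans (le_normr_Rintegral _ _) _ => //.
have -> : e = \int[P]_w e.
  rewrite Rintegral_cst // -[LHS]mulr1; congr (_ * _).
  exact: esym (congr1 fine (probability_setT P)).
apply: le_Rintegral => //; first exact: integrable_norm.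
by apply: (@bounded_integrable _ _ _ P _ _ `|e|).
Qed.

End OneVariable.

(** Truncation costs at most e / 3 on either side, uniformly in N; what remains is a finite
    combination of window probabilities. *)
Lemma cvg_in_distribution_window
    (dN : nat -> measure_display) (TN : forall N, measurableType (dN N))
    (PN : forall N, probability (TN N) R) (XN : forall N, int -> TN N -> bool)
    d (T : measurableType d) (P : probability T R) (X : int -> T -> bool) :
  (forall N n b, measurable (XN N n @^-1` [set b])) ->
  (forall n b, measurable (X n @^-1` [set b])) ->
  (forall k (z : (k.*2.+1).-tuple bool),
    prob (PN N) (window (XN N) (- k%:Z) k.*2.+1 @^-1` [set z]) @[N --> \oo] -->
    prob P (window X (- k%:Z) k.*2.+1 @^-1` [set z])) ->
  cvg_in_distribution PN (fun N => config (XN N)) P (config X).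
Proof.
move=> mXN mX cvgX f f_cont [M f_le].
rewrite (expectation_config P mX f_cont f_le).
under eq_fun do rewrite (expectation_config _ (mXN _) f_cont f_le).
apply: cvg_EFin; first exact: nearW.
apply/cvgrPdist_le => e e_gt0; have e3_gt0 : 0 < e / 3 by rewrite divr_gt0.
have [k le_k] : exists k, forall x, `|f x - f (truncate k x)| <= e / 3.
  have [k _ /(_ k (leqnn k)) lt_k] := uniform_truncate f_cont e3_gt0.
  by exists k => x; exact: ltW.
pose I d (T : measurableType d) (P : probability T R) X := \sum_z f (untruncate z) *
  prob P (window X (- k%:Z) k.*2.+1 @^-1` [set z]).
have cvgI : I _ _ (PN N) (XN N) @[N --> \oo] --> I _ _ P X.
  apply: cvg_big => [|z _]; first exact: add_continuous.
  by apply: cvgM; [exact: cvg_cst | exact: cvgX].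
near=> N; rewrite /=.
have h1 := expectation_truncate P mX f_cont f_le le_k.
have h2 := expectation_truncate (PN N) (mXN N) f_cont f_le le_k.
have h3 : `|I _ _ P X - I _ _ (PN N) (XN N)| <= e / 3.
  by near: N; move/cvgrPdist_le : cvgI; apply.
move: h1 h2 h3; rewrite /I !ler_norml; lra.
Unshelve. all: by end_near.
Qed.

End Windows.

Lemma cyclic_modn N (x : int -> bool) j : cyclic N x ->
  x ((j %% N)%N%:Z + 1) = x (j%:Z + 1).
Proof.
move=> cyc_x; rewrite [in RHS](divn_eq j N); elim: (j %/ N)%N => [|q IHq] //.
by rewrite mulSn IHq -[LHS]cyc_x; congr x; lia.
Qed.

Lemma nth_rot_block N (x : int -> bool) r i : cyclic N x ->
  (i < N)%N -> (r <= N)%N -> nth false (rot r (block N x)) i = x ((r + i)%N%:Z + 1).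
Proof.
move=> cyc_x lt_iN le_rN; rewrite nth_rot ?size_tuple // -(cyclic_modn _ cyc_x).
have lt_mod : ((r + i) %% N < N)%N by rewrite ltn_mod; lia.
rewrite -[X in nth _ _ X]/(nat_of_ord (Ordinal lt_mod)) -tnth_nth tnth_mktuple /=.
by congr x; lia.
Qed.

(** * Windows of cyclic configurations as labels of cyclic words *)

Section CyclicConfigurations.
Variables (R : realType) (E : finType).
Variables (Q : E -> E -> R) (pi : E -> R) (m : nat) (L : E -> E -> bool).
Hypotheses (Q_ge0 : forall x y, 0 <= Q x y) (Q1 : forall x, \sum_y Q x y = 1).
Hypotheses (piQ : invariant_probability Q pi) (m_gt0 : (0 < m)%N).
Hypothesis Qm_gt0 :
  forall x y, 0 < iter m (step_op Q) (fun u => (u == y)%:R) x.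

(** The common core of the three limits. A window of M bits is read off M + 1 letters, since the
    first bit also depends on the letter before it; [good] enters only through the vanishing weight
    of its complement. *)
Lemma cvg_cyclic_configuration
    (dN : nat -> measure_display) (TN : forall N, measurableType (dN N))
    (PN : forall N, probability (TN N) R) (XN : forall N, int -> TN N -> bool)
    d (T : measurableType d) (P : probability T R) (X : int -> T -> bool)
    (Z : int -> T -> E) (good : forall N, pred (N.-tuple E)) :
  (forall N n b, measurable (XN N n @^-1` [set b])) ->
  (forall n x, measurable (Z n @^-1` [set x])) ->
  (forall n w, X n w = L (Z (n - 1) w) (Z n w)) ->
  (forall a M (z : M.+1.-tuple E),
    prob P (window Z a M.+1 @^-1` [set z]) = chain_wt Q pi z) ->
  \sum_(t : N.-tuple E | ~~ good N t) cyc_wt Q t @[N --> \oo] --> (0 : R) ->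
  (forall N, (0 < N)%N ->
    (forall B : pred (seq bool),
      prob (PN N) [set w | B (block N (fun n => XN N n w))] =
      (\sum_(t : N.-tuple E | good N t && B (cyc L t)) cyc_wt Q t) /
      (\sum_(t : N.-tuple E | good N t) cyc_wt Q t)) /\
    forall w, cyclic N (fun n => XN N n w)) ->
  cvg_in_distribution PN (fun N => config (XN N)) P (config X).
Proof.
move=> mXN mZ XE PZ bad0 law.
have mX n b : measurable (X n @^-1` [set b]).
  have mW := fun z => measurable_window (n - 1) z mZ.
  have := measurable_preimage_finite (mW 2)
    [set z : 2.-tuple E | L (tnth z ord0) (tnth z ord_max) = b].
  congr (measurable _); apply/seteqP.
  by split => w /=; rewrite !tnth_mktuple XE addr0 subrK.
apply: cvg_in_distribution_window => // k z; set M := k.*2.+1.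
pose G (u : seq E) := if u is x :: s then pairmap L x s == z :> seq bool else false.
(* Entry i of the block has time i + 1, so this rotation brings time N - k - 1, that is -k - 1, to
   the front: the letter just before the window. The bit at that time is discarded by [behead] in
   [B]. *)
pose r N := (N - k - 2)%N.
have -> : prob P (window X (- k%:Z) M @^-1` [set z]) =
    \sum_(u : M.+1.-tuple E | G u) chain_wt Q pi u.
  under eq_bigr do rewrite -(PZ (- k%:Z - 1)).
  have := prob_finite P (fun z => measurable_window (- k%:Z - 1) z mZ)
    [pred u : M.+1.-tuple E | G u].
  rewrite -[X in _ = X -> _]/(\sum_(u : M.+1.-tuple E | G u) _) => <-.
  congr (prob P _).
  have Gw w : G (window Z (- k%:Z - 1) M.+1 w) = (window X (- k%:Z) M w == z).
    rewrite /G.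
    case defu : (tval (window Z (- k%:Z - 1) M.+1 w)) => [|x s].
      by have := size_tuple (window Z (- k%:Z - 1) M.+1 w); rewrite defu.
    have size_s : size s = M.
      by have := size_tuple (window Z (- k%:Z - 1) M.+1 w); rewrite defu => -[].
    suff -> : pairmap L x s = window X (- k%:Z) M w by [].
    apply: (@eq_from_nth _ false); first by rewrite size_pairmap size_s size_tuple.
    rewrite size_pairmap size_s => i lt_iM.
    rewrite (nth_pairmap x) ?size_s // nth_window // XE.
    rewrite -[nth x s i]/(nth x (x :: s) i.+1) -defu.
    have lt_iM1 : (i < M.+1)%N := leqW lt_iM.
    by rewrite !nth_window //; congr (L (Z _ w) (Z _ w)); lia.
  apply/funext => w; apply/propext.
  rewrite -[X in X <-> _]/(window X (- k%:Z) M w = z).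
  rewrite -[X in _ <-> X]/(is_true (G (window Z (- k%:Z - 1) M.+1 w))) Gw.
  by split => /eqP.
have := @cvg_good_walk_ratio _ _ Q pi m Q_ge0 Q1 piQ m_gt0 Qm_gt0 M.+1 G r
  good (ltn0Sn M) bad0.
apply: cvg_trans; apply: near_eq_cvg; near=> N.
have lt_MN : (M.+1 < N)%N by near: N; exact: nbhs_infty_gt.
have [] := law N (leq_ltn_trans (leq0n _) lt_MN).
pose B (s : seq bool) := take M (behead (rot (r N) s)) == z.
move=> /(_ B) lawB cycN.
have -> : window (XN N) (- k%:Z) M @^-1` [set z] =
    [set w | B (block N (fun n => XN N n w))].
  have Bw w : B (block N (fun n => XN N n w)) = (window (XN N) (- k%:Z) M w == z).
    suff BE : take M (behead (rot (r N) (block N (XN N ^~ w)))) =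
      window (XN N) (- k%:Z) M w by rewrite /B BE.
    have size_tk : size (take M (behead (rot (r N) (block N (XN N ^~ w))))) = M.
      by rewrite size_takel // size_behead size_rot size_tuple; lia.
    apply: (@eq_from_nth _ false); first by rewrite size_tk size_tuple.
    rewrite size_tk => i lt_iM; rewrite nth_take // nth_behead nth_window //.
    rewrite nth_rot_block //; [|by lia|by rewrite /r; lia].
    by rewrite -(cycN w (- k%:Z + i%:Z)); congr (XN N _ w); rewrite /r; lia.
  by apply/seteqP; split => w /=; rewrite Bw => /eqP.
rewrite lawB; congr (_ / _); apply: eq_bigl => t; congr (_ && _).
rewrite /B -cyc_rot.
case defr : (rot (r N) t) => [|x s].
  by have := size_tuple t; rewrite -(size_rot (r N)) defr /=; lia.
rewrite cyc_cons /= ; congr (_ == _).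
have lt_Ms : (M <= size s)%N.
  by have := size_tuple t; rewrite -(size_rot (r N)) defr /=; lia.
by rewrite -{2}(cat_take_drop M s) pairmap_cat take_size_cat ?size_pairmap ?size_takel.
Unshelve. all: by end_near.
Qed.

End CyclicConfigurations.

(** * Independent and two-state Markov configurations *)

Section Laws.
Context {R : realType} {d : measure_display} {T : measurableType d}.
Variable P : probability T R.

Lemma prob_ge0 (A : set T) : 0 <= prob P A.
Proof. by rewrite fine_ge0. Qed.

Lemma prob_le (A B : set T) : measurable A -> measurable B -> A `<=` B ->
  prob P A <= prob P B.
Proof.
by move=> mA mB AB; rewrite fine_le ?fin_num_measure ?le_measure ?inE.
Qed.

Section Markov.
Variables (E : finType) (Q : E -> E -> R) (pi : E -> R) (X : int -> T -> E).
Hypothesis mX : forall n x, measurable (X n @^-1` [set x]).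

Lemma measurable_path a n (z : nat -> E) :
  measurable [set w | forall i, (i <= n)%N -> X (a + i%:Z) w = z i].
Proof.
rewrite (_ : [set w | _] =
  \bigcap_(i in `I_n.+1) (X (a + i%:Z) @^-1` [set z i])).
  by apply: fin_bigcap_measurable => //; exact: finite_II.
by apply/seteqP; split => w Xw i; exact: Xw.
Qed.

Lemma markov_path a x s : stationary_markov_chain P Q pi X ->
  prob P [set w | forall i, (i <= size s)%N -> X (a + i%:Z) w = nth x (x :: s) i] =
  pi x * path_wt Q x s.
Proof.
move=> [_ pX QX]; elim/last_ind: s => [|s y IHs].
  rewrite /path_wt big_nil mulr1 -(pX a); congr (prob P _).
  apply/seteqP; split => w /=; first by move=> /(_ 0%N isT); rewrite addr0.
  by move=> Xw [|//] _; rewrite addr0.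
rewrite path_wt_rcons mulrA -IHs; set past := [set w | _] in IHs *.
have -> : [set w | forall i, (i <= size (rcons s y))%N ->
    X (a + i%:Z) w = nth x (x :: rcons s y) i] =
    [set w | X (a + (size s)%:Z + 1) w = y] `&` past.
  apply/seteqP; split => w /= => [Xw|[Xy Xw] i].
    split => [|i le_i].
      have /= := Xw (size s).+1; rewrite size_rcons nth_rcons ltnn eqxx => <- //.
      by congr (X _ w); lia.
    rewrite Xw ?size_rcons 1?leqW // -rcons_cons nth_rcons /= ltnS le_i //.
  rewrite size_rcons leq_eqVlt ltnS => /predU1P[->|le_i].
    by rewrite /= nth_rcons ltnn eqxx -[RHS]Xy; congr (X _ w); lia.
  by rewrite -rcons_cons nth_rcons /= ltnS le_i Xw.
have mpast : measurable past by exact: measurable_path.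
have mE : measurable [set w | X (a + (size s)%:Z + 1) w = y] by exact: mX.
(* The Markov property is silent on a null past, but there both sides vanish. *)
have [past0|past_neq0] := eqVneq (prob P past) 0.
  rewrite past0 mul0r; apply/eqP; rewrite eq_le prob_ge0 andbT -past0.
  by apply: prob_le => //; exact: measurableI.
have past_gt0 : 0 < prob P past by rewrite lt0r past_neq0 prob_ge0.
(* The same event read backwards from its latest time, as in the Markov property. *)
have pastE : past = [set w | forall i, (i <= size s)%N ->
    X (a + (size s)%:Z - i%:Z) w = nth x (x :: s) (size s - i)].
  apply/seteqP; split => w /= Xw i le_i.
    by rewrite -Xw ?leq_subr //; congr (X _ w); lia.
  have := Xw (size s - i)%N (leq_subr _ _); rewrite subKn // => <-.
  by congr (X _ w); lia.
have := QX (a + (size s)%:Z) (size s) (fun i => nth x (x :: s) (size s - i)) y.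
rewrite /= -pastE => /(_ past_gt0); rewrite /cond_prob subn0 nth_last /= => <-.
by rewrite mulrC divfK.
Qed.

Lemma markov_window a M (z : M.+1.-tuple E) : stationary_markov_chain P Q pi X ->
  prob P (window X a M.+1 @^-1` [set z]) = chain_wt Q pi z.
Proof.
move=> mcX; case/tupleP: z => x s; rewrite /= -(markov_path a) //.
congr (prob P _); apply/seteqP; split => w /=.
  move=> Xw i; rewrite size_tuple => le_i.
  by rewrite -[x :: s]/(tval [tuple of x :: s]) -Xw nth_window.
move=> Xw; apply: val_inj; apply: (@eq_from_nth _ x).
  exact: etrans (size_tuple _) (esym (size_tuple _)).
by move=> i; rewrite [X in (_ < X)%N](size_tuple _) => lt_i;
  rewrite nth_window // Xw ?size_tuple.
Qed.

End Markov.

Definition bit_wt (p : R) (b : bool) : R := if b then p else 1 - p.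

Lemma iid_window (p : R) (X : int -> {RV P >-> bool}) a M (z : M.-tuple bool) :
  0 < p < 1 -> iid_bernoulli p X ->
  prob P (window (fun n => X n : T -> bool) a M @^-1` [set z]) =
  \prod_(b <- z) bit_wt p b.
Proof.
move=> p01 [indX distX].
pose s := [seq a + i%:Z | i <- iota 0 M].
have := indX s (fun n => [set nth false z `|n - a|]) _ _.
have us : uniq s by rewrite map_inj_uniq ?iota_uniq // => i j; lia.
move=> /(_ us (fun _ => I)).
rewrite /s big_map.
have -> : [set w | forall i, i \in [seq a + i%:Z | i <- iota 0 M] ->
    [set nth false z `|(i - a)%R|] (X i w)] =
    window (fun n => X n : T -> bool) a M @^-1` [set z].
  apply/seteqP; split => w /= Xw.
    apply: val_inj; apply: (@eq_from_nth _ false); rewrite !size_tuple // => i lt_iM.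
    rewrite nth_window // Xw; first by congr nth; lia.
    by apply/mapP; exists i => //; rewrite mem_iota.
  move=> _ /mapP[i + ->]; rewrite mem_iota add0n => /= lt_iM.
  have -> : absz (a + i%:Z - a)%R = i by lia.
  by rewrite -Xw nth_window.
move=> ->.
rewrite (big_nth false) size_tuple /index_iota subn0; apply: eq_bigr => i _.
have -> : absz (a + i%:Z - a)%R = i by lia.
rewrite -[prob P _]/(fine (distribution P (X (a + i%:Z)) [set nth false z i])).
rewrite distX bernoulli_probE //.
  rewrite /bit_wt !diracE; case: nth.
    by rewrite mem_set // memNset //= mulr1 mulr0 addr0.
  by rewrite memNset // mem_set //= mulr1 mulr0 add0r.
by case/andP: p01 => p0 p1; rewrite !ltW.
Qed.

End Laws.

(** * Two-state kernels and the weight of words with nonpositive height *)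

Section TwoState.
Variable R : realType.
Implicit Types p : R.

(** In (a) and (b) the letters are the bits themselves: labelling a transition by its target gives
    back the word. *)
Lemma cyc_target (V : Type) (g : bool -> V) s : cyc (fun _ k => g k) s = map g s.
Proof.
rewrite -[in RHS](@unzip2_zip _ _ (rotr 1 s) s) ?size_rotr // -map_comp.
exact: eq_map.
Qed.

(** An i.i.d. sequence is the chain with p0 = p1 = p, so (a) shares the argument of (b), with p <
    1/2 in the role of p0 + p1 < 1. *)
Lemma cyc_wt_iid p s : cyc_wt (two_state_kernel p p) s = \prod_(b <- s) bit_wt p b.
Proof.
rewrite /cyc_wt (_ : cyc _ _ = cyc (fun _ k => bit_wt p k) s); last first.
  by apply: eq_map => -[[] k].
by rewrite cyc_target big_map.
Qed.

Lemma chain_wt_iid p s :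
  chain_wt (two_state_kernel p p) (bit_wt p) s = \prod_(b <- s) bit_wt p b.
Proof.
case: s => [|x s] /=; first by rewrite big_nil.
rewrite big_cons; congr (_ * _); elim: s x => [|y s IHs] x.
  by rewrite /path_wt !big_nil.
by rewrite path_wt_cons big_cons IHs; case: x.
Qed.

Lemma two_state_kernel_gt0 p0 p1 j k : 0 < p0 < 1 -> 0 < p1 < 1 ->
  0 < two_state_kernel p0 p1 j k.
Proof. by rewrite /two_state_kernel; case: j; case: k => /=; lra. Qed.

Lemma two_state_kernel_sum p0 p1 j : \sum_k two_state_kernel p0 p1 j k = 1.
Proof. by rewrite big_bool /two_state_kernel; case: j => /=; lra. Qed.

Lemma invariant_bit_wt p : 0 < p < 1 ->
  invariant_probability (two_state_kernel p p) (bit_wt p).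
Proof.
move=> p01; split=> [x||y]; rewrite ?big_bool /two_state_kernel /bit_wt /=.
- by case: x; lra.
- by lra.
- by case: y => /=; lra.
Qed.

(* S_N as a function of the block (eta_1, ..., eta_N). *)
Definition height (s : seq bool) : int := \sum_(b <- s) (1 - (b : nat)%:Z *+ 2).

Lemma path_encoding_height (x : int -> bool) N n : (n <= N)%N ->
  path_encoding x n%:Z = height (take n (block N x)).
Proof.
move=> le_nN; rewrite /height (big_nth false) size_takel ?size_tuple //.
rewrite /path_encoding big_add1 /=; apply: eq_big_nat => i /= lt_in.
rewrite nth_take //; have lt_iN := leq_trans lt_in le_nN.
by have := tnth_nth false (block N x) (Ordinal lt_iN); rewrite tnth_mktuple /= => <-.
Qed.

(** A Chernoff bound: for th > 1, the factor th^(-S_N) is at least 1 on bad words. It is a product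
    over letters, so the tilted weight is the cyclic weight of a kernel [A]. For the value of th
    below, th > 1 means exactly p0 + p1 < 1. *)
Lemma cvg_two_state_bad p0 p1 : 0 < p0 < 1 -> 0 < p1 < 1 -> p0 + p1 < 1 ->
  \sum_(t : N.-tuple bool | ~~ (0 < height t)) cyc_wt (two_state_kernel p0 p1) t
    @[N --> \oo] --> (0 : R).
Proof.
move=> p0_01 p1_01 p01.
(* This tilting makes the diagonal entries of [A] below equal, and its Perron
   eigenvector is then (1, q / th). *)
pose th := Num.sqrt ((1 - p0) / p1).
have th_gt0 : 0 < th by rewrite sqrtr_gt0 divr_gt0; lra.
have th2 : th * th = (1 - p0) / p1 by rewrite -expr2 sqr_sqrtr // divr_ge0; lra.
have th_gt1 : 1 < th.
  by rewrite -sqrtr1 ltr_sqrt ?divr_gt0 ?ltr_pdivlMr; lra.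
pose A (j k : bool) := two_state_kernel p0 p1 j k * (if k then th else th^-1).
have A_ge0 j k : 0 <= A j k.
  rewrite mulr_ge0 ?(ltW (two_state_kernel_gt0 _ _ _ _)) //.
  by case: k; rewrite ?invr_ge0 ltW.
have cyc_wtA s : cyc_wt A s =
    cyc_wt (two_state_kernel p0 p1) s * th ^ (- height s).
  have -> : th ^ (- height s) = \prod_(b <- s) (if b then th else th^-1).
    elim: s => [|b s IHs]; first by rewrite /height !big_nil oppr0 expr0z.
    rewrite /height !big_cons opprD expfzDr ?gt_eqF // IHs; congr (_ * _).
    by case: b.
  rewrite /cyc_wt -(big_map (fun b : bool => if b then th else th^-1) xpredT id).
  by rewrite -cyc_target !big_map -big_split.
have cA : \sum_(t : N.-tuple bool) cyc_wt A t @[N --> \oo] --> (0 : R).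
  (* With this q the eigenvalue of [A] at (1, q / th) is p1 th + p0 q, shown below to be less than
     1. *)
  pose q := Num.sqrt ((1 - p1) / p0).
  have q_gt0 : 0 < q by rewrite sqrtr_gt0 divr_gt0; lra.
  have q2 : q * q = (1 - p1) / p0 by rewrite -expr2 sqr_sqrtr // divr_ge0; lra.
  apply: (@sum_cyc_wt_superharmonic _ _ A (fun k => if k then q / th else 1)) => //.
    by case=> //; rewrite divr_gt0.
  have e0 : 1 - p0 = p1 * (th * th) by rewrite th2 mulrC divfK //; lra.
  have e1 : 1 - p1 = p0 * (q * q) by rewrite q2 mulrC divfK //; lra.
  (* AM-GM: [2 p1 th < p1 + (1 - p0)] and [2 p0 q <= p0 + (1 - p1)] *)
  have lt1 : p1 * th + p0 * q < 1.
    have : 0 < p1 * (th - 1) ^+ 2 by rewrite mulr_gt0 ?exprn_gt0; lra.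
    have : 0 <= p0 * (q - 1) ^+ 2 by rewrite mulr_ge0 ?sqr_ge0; lra.
    by rewrite !expr2; lra.
  case; rewrite /step_op big_bool /A /two_state_kernel /=.
    rewrite e1 (_ : _ + _ = (p1 * th + p0 * q) * (q / th)).
      by rewrite gtr_pMl // divr_gt0.
    by field; rewrite gt_eqF.
  rewrite e0 (_ : _ + _ = p1 * th + p0 * q) //.
  by field; rewrite gt_eqF.
apply: squeeze_cvgr (cvg_cst 0) cA; apply: nearW => N; apply/andP; split.
  apply: sumr_ge0 => t _; apply: cyc_wt_ge0 => j k.
  exact/ltW/two_state_kernel_gt0.
rewrite [leRHS](bigID (fun t : N.-tuple bool => ~~ (0 < height t))) /=.
rewrite -[leLHS]addr0; apply: lerD; last first.
  by apply: sumr_ge0 => t _; exact: cyc_wt_ge0.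
apply: ler_sum => t; rewrite -leNgt => le_t; rewrite cyc_wtA ler_peMr //.
  by apply: cyc_wt_ge0 => j k; exact/ltW/two_state_kernel_gt0.
have [n ->] : exists n, - height t = Posz n by exists `|height t|%N; lia.
by rewrite -exprnP exprn_ege1 // ltW.
Qed.

End TwoState.

Lemma measurable_rv_fiber (R : realType) d d' (T : measurableType d)
    (E : measurableType d') (P : probability T R) (X : {RV P >-> E}) (x : E) :
  measurable [set x] -> measurable (X @^-1` [set x]).
Proof.
by move=> mx; rewrite -[_ @^-1` _]setTI; apply: measurable_funPT.
Qed.

Lemma block_window T (X : int -> T -> bool) N w :
  block N (fun n => X n w) = window X 1 N w.
Proof. by apply: eq_from_tnth => i; rewrite !tnth_mktuple intS. Qed.

Lemma conditional_law_block (R : realType) d d' (T : measurableType d)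
    (T' : measurableType d') (P : probability T R) (P' : probability T' R)
    (X : int -> T -> bool) (Y : int -> T' -> bool) N (C : pred (seq bool))
    (A : set T) (wt : seq bool -> R) :
  (forall n b, measurable (X n @^-1` [set b])) ->
  (forall n b, measurable (Y n @^-1` [set b])) ->
  (forall w, A w <-> C (block N (fun n => X n w))) ->
  (forall z : N.-tuple bool, prob P (window X 1 N @^-1` [set z]) = wt z) ->
  has_conditional_law P' (fun w => block N (fun n => Y n w))
    P (fun w => block N (fun n => X n w)) A ->
  forall B : pred (seq bool),
    prob P' [set w | B (block N (fun n => Y n w))] =
    (\sum_(t : N.-tuple bool | C t && B t) wt t) /
    (\sum_(t : N.-tuple bool | C t) wt t).
Proof.
move=> mX mY AC wtE law B.
have sum_wt (D : pred (seq bool)) :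
    prob P [set w | D (block N (fun n => X n w))] =
    \sum_(t : N.-tuple bool | D t) wt t.
  under [RHS]eq_bigr do rewrite -wtE.
  rewrite -[RHS](prob_finite P (fun z => measurable_window 1 z mX)
    [pred t : N.-tuple bool | D t]).
  by congr (prob P _); apply/funext => w /=; rewrite block_window.
have /= -> := law [set t : N.-tuple bool | B t].
rewrite /cond_prob -(sum_wt (fun s => C s && B s)) -(sum_wt C).
congr (prob P _ / prob P _); apply/funext => w; apply/propext; rewrite /= AC //.
by split=> [[-> ->]|/andP[]].
Qed.

Lemma cvg_two_state (R : realType) d (T : measurableType d) (P : probability T R)
    (dN : nat -> measure_display) (TN : forall N, measurableType (dN N))
    (PN : forall N, probability (TN N) R) (XN : forall N, int -> TN N -> bool)
    (X : int -> T -> bool) (p0 p1 : R) (nu : bool -> R) :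
  (forall N n b, measurable (XN N n @^-1` [set b])) ->
  (forall n b, measurable (X n @^-1` [set b])) ->
  0 < p0 < 1 -> 0 < p1 < 1 -> p0 + p1 < 1 ->
  invariant_probability (two_state_kernel p0 p1) nu ->
  (forall a M (z : M.+1.-tuple bool),
    prob P (window X a M.+1 @^-1` [set z]) =
    chain_wt (two_state_kernel p0 p1) nu z) ->
  (forall N, (0 < N)%N ->
    (forall B : pred (seq bool),
      prob (PN N) [set w | B (block N (fun n => XN N n w))] =
      (\sum_(t : N.-tuple bool | (0 < height t) && B t)
        cyc_wt (two_state_kernel p0 p1) t) /
      (\sum_(t : N.-tuple bool | 0 < height t)
        cyc_wt (two_state_kernel p0 p1) t)) /\
    forall w, cyclic N (fun n => XN N n w)) ->
  cvg_in_distribution PN (fun N => config (XN N)) P (config X).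
Proof.
move=> mXN mX p0_01 p1_01 p01 invnu chainX law.
(* All entries of the kernel are positive, so m = 1 suffices. *)
apply: (@cvg_cyclic_configuration R bool (two_state_kernel p0 p1) nu 1
  (fun _ k => k) _ _ _ _ _ dN TN PN XN d T P X X
  (fun N (t : N.-tuple bool) => 0 < height t)) => //.
- by move=> j k; exact/ltW/two_state_kernel_gt0.
- exact: two_state_kernel_sum.
- move=> j k; rewrite /= /step_op (bigD1 k) //= eqxx mulr1.
  rewrite big1 ?addr0 ?two_state_kernel_gt0 // => i /negbTE->.
  by rewrite mulr0.
- exact: cvg_two_state_bad.
move=> N N_gt0; have [lawN cycN] := law N N_gt0; split=> // B.
rewrite lawN; congr (_ / _); apply: eq_bigl => t.
by rewrite cyc_target map_id.
Qed.

Lemma cvg_iid (R : realType) (p : R) (d : measure_display) (T : measurableType d)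
    (P : probability T R) (eta : int -> {RV P >-> bool})
    (dN : nat -> measure_display) (TN : forall N, measurableType (dN N))
    (PN : forall N, probability (TN N) R)
    (etaN : forall N, int -> {RV (PN N) >-> bool}) :
  0 < p < 2^-1 -> iid_bernoulli p eta ->
  (forall N : nat, (0 < N)%N ->
    has_conditional_law (PN N) (fun w => block N (fun n => etaN N n w))
      P (fun w => block N (fun n => eta n w))
      [set w | 0 < path_encoding (fun n => eta n w) N] /\
    forall w, cyclic N (fun n => etaN N n w)) ->
  cvg_in_distribution PN (fun N => config (fun n => etaN N n))
    P (config (fun n => eta n)).
Proof.
move=> p_lt iid law; have p01 : 0 < p < 1 by lra.
have mX n b : measurable (eta n @^-1` [set b]) by exact: measurable_rv_fiber.
have mXN N n b : measurable (etaN N n @^-1` [set b]).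
  exact: measurable_rv_fiber.
apply: (@cvg_two_state _ _ _ _ _ _ _ (fun N n => etaN N n : TN N -> bool)
  (fun n => eta n : T -> bool) p p (bit_wt p)) => //; first by lra.
- exact: invariant_bit_wt.
- by move=> a M z; rewrite (iid_window _ _ p01 iid) chain_wt_iid.
move=> N N_gt0; have [lawN cycN] := law N N_gt0; split=> // B.
apply: (@conditional_law_block _ _ _ _ _ _ _ (fun n => eta n : T -> bool)
  (fun n => etaN N n : TN N -> bool) N (fun s => 0 < height s) _
  (cyc_wt (two_state_kernel p p)) mX (mXN N) _ _ lawN) => [w|z].
  rewrite -[X in X <-> _]/(is_true (0 < path_encoding (fun n => eta n w) N)).
  by rewrite (path_encoding_height _ (leqnn N)) take_oversize ?size_tuple.
by rewrite (iid_window _ _ p01 iid) cyc_wt_iid.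
Qed.

(** Allows 1/nu(eta_0) to be cancelled: some state is charged, and one step of a positive kernel
    spreads its mass everywhere. *)
Lemma invariant_two_state_gt0 (R : realType) (p0 p1 : R) nu j :
  0 < p0 < 1 -> 0 < p1 < 1 ->
  invariant_probability (two_state_kernel p0 p1) nu -> 0 < nu j.
Proof.
move=> p0_01 p1_01 [nu_ge0 nu1 nuQ].
have h k : 0 < nu k -> 0 < nu j.
  move=> nu_k; rewrite -nuQ (bigD1 k) //= ltr_pwDl //.
    by rewrite mulr_gt0 ?two_state_kernel_gt0.
  by apply: sumr_ge0 => i _; rewrite mulr_ge0 // ltW ?two_state_kernel_gt0.
have [k nu_k] : exists k, 0 < nu k.
  have := nu_ge0 false; rewrite le_eqVlt => /predU1P[nu0|]; last by exists false.
  by exists true; move: nu1; rewrite big_bool /= -nu0; lra.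
exact: h nu_k.
Qed.

(** On the window of times 0, ..., N the stationary weight is nu(x_0) times a path weight. The
    reweighting cancels nu(x_0), and x_0 = x_N makes the path weight the cyclic weight of x_1, ...,
    x_N. *)
Lemma markov_reweighted_integral (R : realType) (p0 p1 : R) (nu : bool -> R)
    d (T : measurableType d) (P : probability T R) (X : int -> T -> bool) N
    (F : seq bool -> R) :
  (0 < N)%N -> 0 < p0 < 1 -> 0 < p1 < 1 ->
  (forall n b, measurable (X n @^-1` [set b])) ->
  stationary_markov_chain P (two_state_kernel p0 p1) nu X ->
  \int[P]_(w in [set w | X N w = X 0 w /\
      0 < path_encoding (fun n => X n w) N])
    ((nu (X 0 w))^-1 * F (block N (fun n => X n w))) =
  \sum_(t : N.-tuple bool | 0 < height t) F t * cyc_wt (two_state_kernel p0 p1) t.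
Proof.
move=> N_gt0 p0_01 p1_01 mX mc; have [invnu _ _] := mc.
pose Y := window X 0 N.+1.
have mY z : measurable (Y @^-1` [set z]) by exact: measurable_window.
pose D (s : seq bool) := (last false s == head false s) && (0 < height (behead s)).
have YE w : tval (Y w) = X 0 w :: block N (fun n => X n w).
  apply: (@eq_from_nth _ false) => [|i].
    exact: etrans (size_tuple _) (esym (congr1 S (size_tuple _))).
  rewrite [X in (_ < X)%N]size_tuple => lt_i; rewrite nth_window // add0r.
  case: i lt_i => // i lt_i.
  by rewrite block_window /= nth_window // intS.
have lastY w : last false (Y w) = X N w.
  by rewrite -nth_last size_tuple nth_window // add0r.
have -> : [set w | X N w = X 0 w /\ 0 < path_encoding (fun n => X n w) N] =
    Y @^-1` [set z : N.+1.-tuple bool | D z].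
  apply/funext => w; apply/propext.
  rewrite -[X in X <-> _]/(X N w = X 0 w /\
    0 < path_encoding (fun n => X n w) N) -[X in _ <-> X]/(is_true (D (Y w))).
  rewrite /D lastY YE (path_encoding_height _ (leqnn N)).
  rewrite take_oversize ?size_tuple //.
  by split=> [[-> ->]|/andP[/eqP -> ->]]; rewrite ?eqxx.
pose g (z : seq bool) := (nu (head false z))^-1 * F (behead z).
under eq_Rintegral => w _.
  rewrite (_ : _ * _ = (g \o val) (Y w)); last by rewrite /g /= YE.
  over.
rewrite (Rintegral_finite P mY (g \o val)); last exact: measurable_preimage_finite.
pose G s := if D s then
  F (behead s) * path_wt (two_state_kernel p0 p1) (head false s) (behead s) else 0.
transitivity (\sum_(z : N.+1.-tuple bool) G z).
  apply: eq_bigr => z _; rewrite /G /=; case: ifPn => Dz; last first.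
    rewrite (_ : _ `&` _ = set0); last first.
      by apply/seteqP; split => w // -[Dw Yw]; case/negP: Dz; rewrite -Yw.
    by rewrite /prob measure0 mulr0.
  rewrite (_ : _ `&` _ = Y @^-1` [set z]); last first.
    by apply/seteqP; split => w => [[]|Yw] //; split=> //; rewrite -Yw in Dz.
  rewrite (markov_window mX _ _ mc) // /g; case/tupleP: z {Dz} => x s /=.
  by rewrite mulrACA mulVf ?mul1r ?gt_eqF ?(invariant_two_state_gt0 _ p0_01 p1_01).
(* For fixed x_1, ..., x_N only the start x_0 = x_N survives, and its step into x_1 closes the
   cycle. *)
rewrite (big_tuple_cons N G) exchange_big [RHS]big_mkcond /=; apply: eq_bigr => t _.
case: t => -[|x s] size_t /=; first by exfalso; move/eqP: (size_t) N_gt0 => /= <-.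
rewrite /G /D /= (bigD1 (last x s)) //= eqxx /= big1 ?addr0 => [|y neq_y].
  by case: ifP => // _; rewrite path_wt_cons cyc_wt_cons.
by rewrite eq_sym (negbTE neq_y).
Qed.

Lemma cvg_markov (R : realType) (p0 p1 : R) (nu : bool -> R)
    (d : measure_display) (T : measurableType d)
    (P : probability T R) (eta : int -> {RV P >-> bool})
    (dN : nat -> measure_display) (TN : forall N, measurableType (dN N))
    (PN : forall N, probability (TN N) R)
    (etaN : forall N, int -> {RV (PN N) >-> bool}) :
  0 < p0 < 1 -> 0 < p1 < 1 -> p0 + p1 < 1 ->
  stationary_markov_chain P (two_state_kernel p0 p1) nu (fun n => eta n) ->
  (forall N : nat, (0 < N)%N ->
    let A := [set w | eta N w = eta 0 w /\
      0 < path_encoding (fun n => eta n w) N] in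
    (forall F : N.-tuple bool -> R,
      ('E_(PN N)[fun w => F (block N (fun n => etaN N n w))] =
        (cond_expect P
           (fun w => (nu (eta 0 w))^-1 * F (block N (fun n => eta n w))) A /
         cond_expect P (fun w => (nu (eta 0 w))^-1) A)%:E)%E) /\
    forall w, cyclic N (fun n => etaN N n w)) ->
  cvg_in_distribution PN (fun N => config (fun n => etaN N n))
    P (config (fun n => eta n)).
Proof.
move=> p0_01 p1_01 p01 mc law.
have mX n b : measurable (eta n @^-1` [set b]) by exact: measurable_rv_fiber.
have mXN N n b : measurable (etaN N n @^-1` [set b]).
  exact: measurable_rv_fiber.
have [invnu _ _] := mc.
apply: (@cvg_two_state _ _ _ _ _ _ _ (fun N n => etaN N n : TN N -> bool)
  (fun n => eta n : T -> bool) p0 p1 nu) => //.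
  by move=> a M z; exact: markov_window.
move=> N N_gt0; have [] := law N N_gt0; set A := [set w | _] => lawN cycN; split=> // B.
have intA := fun F => markov_reweighted_integral F N_gt0 p0_01 p1_01 mX mc.
have := intA (fun=> 1); under eq_Rintegral do rewrite mulr1.
under [X in _ = X -> _]eq_bigr do rewrite mul1r.
move=> int1.
(* Division by 0 gives 0, so with a null [A] the characterisation of the law at F = 1 would read 1 =
   0. *)
have prob_neq0 : prob P A != 0.
  have := lawN (fun=> 1); apply: contra_eqN => /eqP P0.
  rewrite /cond_expect P0 invr0 !mulr0 mul0r.
  by rewrite -/(cst 1) expectation_cst; apply/eqP => -[]; lra.
have cancel (a b : R) : a / prob P A / (b / prob P A) = a / b.
  by rewrite invfM invrK mulrACA mulVf // mulr1.
have mB (b : N.-tuple bool) :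
    measurable ((fun w => block N (fun n => etaN N n w)) @^-1` [set b]).
  rewrite (_ : _ @^-1` _ = window (fun n => etaN N n : TN N -> bool) 1 N @^-1` [set b]).
    exact: measurable_window.
  by apply/funext => w; congr (_ = b).
have := lawN (fun b => (B b)%:R).
rewrite /cond_expect cancel int1 (intA (fun b => (B b)%:R)).
rewrite (_ : (fun w => _) = \1_[set w | B (block N (fun n => etaN N n w))]).
  rewrite expectation_indic; last first.
    exact: (measurable_preimage_finite mB [set b : N.-tuple bool | B b]).
  rewrite /prob => -> /=; congr (_ / _).
  rewrite big_mkcondr; apply: eq_bigr => t _.
  by case: (B t); rewrite ?mul1r ?mul0r.
apply/funext => w; rewrite indicE; congr ((nat_of_bool _)%:R).
by apply/idP/idP => [Bw|/set_mem //]; exact/mem_set.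
Qed.

(** * Bounded solitons *)

Lemma max_rangeP a b (f : nat -> int) c : (a <= b)%N ->
  reflect (forall i, (a <= i <= b)%N -> f i <= c) (max_range a b f <= c).
Proof.
move=> le_ab; apply: (iffP idP) => [le_c i /andP[le_ai le_ib]|le_c].
  apply: le_trans le_c; rewrite /max_range.
  by apply: le_bigmax_seq; rewrite // mem_index_iota ltnS le_ai le_ib.
rewrite /max_range big_seq; apply: bigmax_le => [|i]; first by rewrite le_c ?leqnn.
by rewrite mem_index_iota ltnS => /le_c.
Qed.

(** By integrality, an unattained maximum would be at most itself minus 1. *)
Lemma max_range_attained a b (f : nat -> int) : (a <= b)%N ->
  exists2 i, (a <= i <= b)%N & max_range a b f = f i.
Proof.
move=> le_ab; apply: contrapT => none.
have : max_range a b f <= max_range a b f - 1.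
  apply/(max_rangeP _ _ le_ab) => i le_i.
  have : f i <= max_range a b f by apply/(max_rangeP _ _ le_ab) : le_i.
  have : max_range a b f <> f i by move=> e; apply: none; exists i.
  by lia.
by lia.
Qed.

Lemma bounded_solitonsP N K (S : int -> int) :
  bounded_solitons N K S <->
  forall n : nat, (n <= N)%N ->
    (forall m : nat, (m <= n)%N -> S m - S n <= K%:Z) /\
    (forall m : nat, (n <= m <= N)%N -> S m - S N - S n <= K%:Z).
Proof.
rewrite /bounded_solitons; split.
  move=> /(max_rangeP _ _ (leq0n N)) le_K n le_nN; have := le_K n le_nN.
  rewrite ge_max => /andP[/(max_rangeP _ _ (leq0n n)) h1 /(max_rangeP _ _ le_nN) h2].
  by split.
move=> le_K; apply/(max_rangeP _ _ (leq0n N)) => n /= le_nN.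
have [h1 h2] := le_K n le_nN; rewrite ge_max; apply/andP; split.
  exact/(max_rangeP _ _ (leq0n n)).
exact/(max_rangeP _ _ le_nN).
Qed.

(* [V n = W n + S n], for [W] the carrier, is the running maximum of the path. *)
Definition carrier_path N (S V : nat -> int) :=
  [/\ S 0%N = 0, 0 <= V 0%N, V N = V 0%N + S N &
      forall j, (j < N)%N -> V j.+1 = Num.max (V j) (S j.+1)].

Section CarrierPath.
Variables (N : nat) (S : nat -> int).
Implicit Types V : nat -> int.

Lemma carrier_path_homo V : carrier_path N S V ->
  forall m n, (m <= n <= N)%N -> V m <= V n.
Proof.
move=> [_ _ _ VS] m n /andP[/subnK <-]; elim: (n - m)%N => [|k IHk] le_N //.
have := IHk (ltnW le_N); rewrite addSn VS // => /le_trans; apply.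
by rewrite le_max lexx.
Qed.

Lemma carrier_path_ge V : carrier_path N S V ->
  forall n, (n <= N)%N -> S n <= V n.
Proof.
move=> [S0 V0 _ VS] [|n] lt_nN; first by rewrite S0.
by rewrite VS // le_max lexx orbT.
Qed.

(** Where V increases it equals S, which lies below V'. The recursion is monotone and carries the
    inequality on to N; both paths gain S N over a period, so it holds at 0 and then everywhere. *)
Lemma carrier_path_le V V' : carrier_path N S V -> carrier_path N S V' ->
  (exists2 j, (j < N)%N & V j < V j.+1) ->
  forall n, (n <= N)%N -> V n <= V' n.
Proof.
move=> cV cV' [j lt_jN incr]; have [_ _ VN VS] := cV; have [_ _ VN' VS'] := cV'.
have prop m n : (m <= n <= N)%N -> V m <= V' m -> V n <= V' n.
  move=> /andP[/subnK <-]; elim: (n - m)%N => [|k IHk] le_N le_m //.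
  rewrite addSn VS // VS' // ge_max !le_max lexx orbT andbT.
  by rewrite (IHk (ltnW le_N)).
have le_j1 : V j.+1 <= V' j.+1.
  apply: le_trans (carrier_path_ge cV' lt_jN).
  by move: incr; rewrite VS // lt_max ltxx /= => lt_V; rewrite ge_max lexx ltW.
have le_N := prop _ _ (_ : (j.+1 <= N <= N)%N) le_j1.
have le_0 : V 0%N <= V' 0%N by have := le_N _; rewrite lt_jN leqnn; lia.
by move=> n le_nN; apply: (prop 0%N).
Qed.

(** V is nondecreasing and dominates S. Hence S m <= V m <= V n for m <= n, and S m - S N <= V N - S
    N = V 0 <= V n for m >= n. *)
Lemma carrier_path_bounded V K : carrier_path N S V ->
  (forall n, (n <= N)%N -> V n - S n <= K%:Z) ->
  bounded_solitons N K (fun n => S `|n|%N).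
Proof.
move=> cV leK; have [_ _ VN _] := cV.
apply/bounded_solitonsP => n le_nN; have leVK := leK n le_nN; split=> m le_m.
  have := carrier_path_ge cV (leq_trans le_m le_nN).
  have := carrier_path_homo cV (_ : (m <= n <= N)%N); rewrite le_m le_nN /=.
  by move=> /(_ isT); lia.
case/andP: le_m => le_nm le_mN.
have := carrier_path_ge cV le_mN.
have := carrier_path_homo cV (_ : (m <= N <= N)%N); rewrite le_mN leqnn.
have := carrier_path_homo cV (_ : (0 <= n <= N)%N); rewrite le_nN.
by move=> /(_ isT) + /(_ isT) /=; lia.
Qed.

Lemma carrier_path_exists K : S 0%N = 0 -> 0 < S N ->
  bounded_solitons N K (fun n => S `|n|%N) ->
  exists V, [/\ carrier_path N S V, exists2 j, (j < N)%N & V j < V j.+1 &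
    forall n, (n <= N)%N -> V n - S n <= K%:Z].
Proof.
move=> S0 SN_gt0 /bounded_solitonsP /= bd.
have [m0 le_m0 maxE] := max_range_attained S (leq0n N).
set mx := max_range _ _ _ in maxE.
have le_mx n : (n <= N)%N -> S n <= mx.
  by move=> le_nN; apply/(max_rangeP _ _ (leq0n N)) : (n) le_nN.
(* The start is the supremum of the periodic extension of S over times up to 0: each earlier period
   is lowered by S N > 0, so the last one before 0 decides, with maximum mx - S N. *)
pose V := fix V n := if n is k.+1 then Num.max (V k) (S k.+1) else mx - S N.
have V0_ge0 : 0 <= V 0%N by rewrite subr_ge0 le_mx.
have V_attained n : V n = V 0%N \/ exists2 m, (m <= n)%N & V n = S m.
  elim: n => [|n [IHn|[m le_mn IHn]]]; first by left.
    by rewrite /=; case: leP => _; [right; exists n.+1 | left].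
  by right; rewrite /=; case: leP => _; [exists n.+1 | exists m => //; exact: leqW].
have V_ge m n : (0 < m <= n)%N -> S m <= V n.
  elim: n => [|n IHn]; first by lia.
  rewrite /= le_max; have [->|neq_m] := eqVneq m n.+1; first by rewrite lexx orbT.
  by move=> le_m; rewrite IHn //; lia.
have VN : V N = V 0%N + S N.
  apply/eqP; rewrite /= subrK eq_le; apply/andP; split.
    have [->|[m le_mN ->]] := V_attained N; last exact: le_mx.
    by rewrite /=; lia.
  rewrite maxE V_ge //; case: m0 maxE le_m0 => [|//] mx0.
  by have := le_mx N (leqnn N); rewrite mx0 S0; lia.
exists V; split.
- by split.
- apply: contrapT => none.
  have V_le n : (n <= N)%N -> V n <= V 0%N.
    elim: n => // n IHn lt_nN; apply: le_trans (IHn (ltnW lt_nN)).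
    by rewrite leNgt; apply/negP => incr; apply: none; exists n.
  by have := V_le N (leqnn N); lia.
move=> n le_nN; have [bd1 bd2] := bd n le_nN.
have [->|[m le_mn ->]] := V_attained n; last exact: bd1.
(* Here V n = S m0 - S N. The second clause of the bound covers n <= m0; past the maximum, the first
   clause bounds S m0 - S n, and S N > 0 does the rest. *)
rewrite /= maxE; have [le_n|lt_n] := leqP n m0.
  by apply: bd2; rewrite le_n; lia.
by have := bd1 m0 (ltnW lt_n); lia.
Qed.

End CarrierPath.

(** The position at time j of the closed walk whose positions at times 1, ..., N are listed by [t];
    time 0 takes the last letter. *)
Definition cyc_pos (E : Type) (x0 : E) t j := nth x0 (last x0 t :: t) j.

Lemma nth_cyc (E V : Type) (f : E -> E -> V) x0 v0 t j : (j < size t)%N ->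
  nth v0 (cyc f t) j = f (cyc_pos x0 t j) (cyc_pos x0 t j.+1).
Proof.
case: t => // x s lt_j.
rewrite cyc_cons -[_ :: pairmap _ _ _]/(pairmap f (last x s) (x :: s)).
by rewrite (nth_pairmap x0).
Qed.

Lemma cyc_pos_size (E : Type) (x0 : E) t : (0 < size t)%N ->
  cyc_pos x0 t (size t) = cyc_pos x0 t 0.
Proof. by case: t => // x s _; rewrite /cyc_pos /= -last_nth. Qed.

Lemma height_takeS b j : (j < size b)%N ->
  height (take j.+1 b) = height (take j b) + (1 - (nth false b j : nat)%:Z *+ 2).
Proof.
by move=> lt_j; rewrite (take_nth false) // /height -cats1 big_cat big_seq1.
Qed.

(** * Closed walks of the carrier and their words of labels *)

Section SolitonWalks.
Variable K : nat.
Implicit Types (x y : 'I_K.+1) (t : seq 'I_K.+1) (b : seq bool).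

Definition step_label x y := y%:Z - x%:Z == 1.

Definition stay x y := (x == 0%N :> nat) && (y == 0%N :> nat).

Definition carrier_step x y :=
  [|| y == x.+1 :> nat, x == y.+1 :> nat | stay x y].

Definition closed_walk t := all id (cyc carrier_step t).

Definition has_stay t := has id (cyc stay t).

(** [bounded_solitons] expects a path on the integers but reads it at times 0, ..., N only; the
    absolute value is a conversion. *)
Definition soliton_word b :=
  `[< bounded_solitons (size b) K (fun n => height (take `|n|%N b)) >] &&
  (0 < height b).

(** A step of W up or down is compensated by S and leaves V = W + S fixed. A stay at 0 raises S by 1
    from V = S, so V follows. *)
Lemma closed_walk_carrier t : (0 < size t)%N -> closed_walk t ->
  carrier_path (size t) (fun j => height (take j (cyc step_label t)))
    (fun j => (cyc_pos ord0 t j)%:Z + height (take j (cyc step_label t))).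
Proof.
move=> t_gt0 walk_t; split.
- by rewrite take0 /height big_nil.
- by rewrite take0 /height big_nil addr0.
- by rewrite cyc_pos_size // take0 /height big_nil addr0.
move=> j lt_j; rewrite height_takeS ?size_cyc // (nth_cyc _ ord0) //.
have : carrier_step (cyc_pos ord0 t j) (cyc_pos ord0 t j.+1).
  rewrite -(nth_cyc _ _ true) //; apply: (allP walk_t).
  by rewrite mem_nth // size_cyc.
by rewrite /carrier_step /step_label /stay; case: eqP; lia.
Qed.

Lemma has_stay_incr t : (0 < size t)%N -> has_stay t ->
  exists2 j, (j < size t)%N &
    (cyc_pos ord0 t j)%:Z + height (take j (cyc step_label t)) <
    (cyc_pos ord0 t j.+1)%:Z + height (take j.+1 (cyc step_label t)).
Proof.
move=> t_gt0 /(has_nthP true)[j]; rewrite size_cyc => lt_j.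
rewrite (nth_cyc _ ord0) // => stay_j; exists j => //.
rewrite height_takeS ?size_cyc // (nth_cyc _ ord0) //.
by move: stay_j; rewrite /step_label /stay; case: eqP; lia.
Qed.

Lemma soliton_word_label t : (0 < size t)%N -> closed_walk t -> has_stay t ->
  soliton_word (cyc step_label t).
Proof.
move=> t_gt0 walk_t stay_t; have cV := closed_walk_carrier t_gt0 walk_t.
have [j lt_j incr] := has_stay_incr t_gt0 stay_t.
apply/andP; split.
  apply/asboolP; rewrite size_cyc; apply: (carrier_path_bounded cV) => n _.
  by rewrite addrK; have := ltn_ord (cyc_pos ord0 t n); lia.
have [S0 _ VN _] := cV.
have h1 := carrier_path_homo cV (ltnW lt_j : (0 <= j <= size t)%N).
have jN : (j.+1 <= size t <= size t)%N by rewrite lt_j leqnn.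
have h2 := carrier_path_homo cV jN.
have <- : height (take (size t) (cyc step_label t)) = height (cyc step_label t).
  by rewrite take_oversize // size_cyc.
by move: h1 h2 incr VN => /=; lia.
Qed.

Lemma closed_walk_inj t t' : (0 < size t)%N -> size t = size t' ->
  closed_walk t -> has_stay t -> closed_walk t' -> has_stay t' ->
  cyc step_label t = cyc step_label t' -> t = t'.
Proof.
move=> t_gt0 eq_size wt st wt' st' eq_lab.
have t'_gt0 : (0 < size t')%N by rewrite -eq_size.
have cV := closed_walk_carrier t_gt0 wt.
have cV' := closed_walk_carrier t'_gt0 wt'.
have incr := has_stay_incr t_gt0 st; have incr' := has_stay_incr t'_gt0 st'.
rewrite -eq_size -eq_lab in cV' incr'.
apply: (@eq_from_nth _ ord0) => // j lt_j.
rewrite -[nth _ t _]/(cyc_pos ord0 t j.+1) -[nth _ t' _]/(cyc_pos ord0 t' j.+1).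
apply: val_inj => /=.
have := carrier_path_le cV cV' incr lt_j.
have := carrier_path_le cV' cV incr' lt_j.
by rewrite /=; lia.
Qed.

Lemma closed_walk_exists b : (0 < size b)%N -> soliton_word b ->
  exists t, [/\ size t = size b, closed_walk t, has_stay t &
    cyc step_label t = b].
Proof.
move=> b_gt0 /andP[/asboolP bd hb].
have S0 : height (take 0 b) = 0 by rewrite take0 /height big_nil.
have SN : height (take (size b) b) = height b by rewrite take_size.
have [||V [cV [j lt_j incr] leK]] :=
  @carrier_path_exists (size b) (fun j => height (take j b)) K S0.
- by rewrite SN.
- exact: bd.
have [_ _ VN VS] := cV.
pose w n := `|V n - height (take n b)|%N.
have wE n : (n <= size b)%N -> (w n)%:Z = V n - height (take n b).
  by move=> le_n; rewrite /w; have /= := carrier_path_ge cV le_n; lia.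
have w_le n : (n <= size b)%N -> (w n < K.+1)%N.
  by move=> le_n; have := leK n le_n; have := wE n le_n; lia.
(* The walk lists W_1, ..., W_N; the time 0 supplied by [cyc_pos] is right because V N = V 0 + S N
   means W_N = W_0. *)
pose t : seq 'I_K.+1 := mkseq (fun i => inord (w i.+1)) (size b).
have size_t : size t = size b by rewrite size_mkseq.
have posE n : (n <= size b)%N -> cyc_pos ord0 t n = w n :> nat.
  case: n => [_|n lt_n]; last by rewrite /cyc_pos /= nth_mkseq // inordK // w_le.
  rewrite -cyc_pos_size ?size_t //; rewrite -{1}(prednK b_gt0) /cyc_pos /=.
  rewrite nth_mkseq ?ltn_predL // prednK // inordK ?w_le //.
  by have := wE _ (leqnn (size b)); have := wE _ (leq0n (size b)); lia.
have step i : (i < size b)%N ->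
    [/\ carrier_step (cyc_pos ord0 t i) (cyc_pos ord0 t i.+1),
      step_label (cyc_pos ord0 t i) (cyc_pos ord0 t i.+1) = nth false b i &
      V i < V i.+1 -> stay (cyc_pos ord0 t i) (cyc_pos ord0 t i.+1)].
  move=> lt_i; rewrite /carrier_step /step_label /stay !posE // 1?ltnW //.
  have := wE i (ltnW lt_i); have := wE i.+1 lt_i; rewrite VS // height_takeS //.
  by case: (nth false b i) => /=; split; lia.
exists t; split => //.
- apply/(all_nthP true) => i; rewrite size_cyc size_t => lt_i.
  by rewrite (nth_cyc _ ord0) ?size_t //; case: (step i lt_i).
- apply/(has_nthP true); exists j; first by rewrite size_cyc size_t.
  by rewrite (nth_cyc _ ord0) ?size_t //; case: (step j lt_j) => _ _; apply.
apply: (@eq_from_nth _ false) => [|i]; rewrite size_cyc size_t // => lt_i.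
by rewrite (nth_cyc _ ord0) ?size_t //; case: (step i lt_i).
Qed.

Section Weights.
Variables (R : realType) (p : R).

(** A step up has weight p and label 1, a step down or a stay has weight 1 - p and label 0: the
    weight of a closed walk is the Bernoulli probability of its labels. *)
Lemma cyc_wt_closed_walk t :
  cyc_wt (walk_mx p K) t =
  if closed_walk t then \prod_(b <- cyc step_label t) bit_wt p b else 0.
Proof.
rewrite /cyc_wt /closed_walk /cyc; elim: (zip _ _) => [|[x y] s IHs].
  by rewrite !big_nil.
rewrite /= !big_cons IHs /= /carrier_step mxE /walk_kernel /bit_wt /step_label /stay.
case: ifP => [/eqP ->|neq_y] /=.
  by rewrite intS addrK eqxx; case: all => //; rewrite mulr0.
rewrite (_ : y%:Z - x%:Z == 1 = false); last by lia.
by case: ifP => _; case: all => //; rewrite ?mulr0 ?mul0r.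
Qed.

(** The fibre of the labelling over a soliton word is a single closed walk with a stay, by
    [closed_walk_exists] and [closed_walk_inj]. *)
Lemma sum_soliton_words N (D : pred (seq bool)) : (0 < N)%N ->
  \sum_(b : N.-tuple bool | soliton_word b && D b) \prod_(k <- b) bit_wt p k =
  \sum_(t : N.-tuple 'I_K.+1 | has_stay t && D (cyc step_label t))
    cyc_wt (walk_mx p K) t.
Proof.
move=> N_gt0; apply/esym.
rewrite (eq_bigr (fun t : N.-tuple 'I_K.+1 => if closed_walk t then
  \prod_(b <- cyc step_label t) bit_wt p b else 0)); last first.
  by move=> t _; exact: cyc_wt_closed_walk.
rewrite -big_mkcondr.
have size_lab (t : N.-tuple 'I_K.+1) : size (cyc step_label t) == N.
  by rewrite size_cyc size_tuple.
rewrite (partition_big (fun t : N.-tuple 'I_K.+1 => Tuple (size_lab t))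
  (fun b : N.-tuple bool => soliton_word b && D b)); last first.
  move=> t /andP[/andP[st Dt] wt] /=; rewrite Dt andbT.
  by apply: soliton_word_label; rewrite ?size_tuple.
apply: eq_bigr => b /andP[sb Db].
have [||t [size_t wt st lab_t]] := @closed_walk_exists b; rewrite ?size_tuple //.
have size_tN : size t == N by rewrite size_t size_tuple.
rewrite (big_pred1 (Tuple size_tN)) /= ?lab_t // => t'.
apply/idP/eqP => [/andP[/andP[/andP[st' _] wt'] /eqP/(congr1 val)/= lab_t']|->].
  apply: val_inj => /=; apply: closed_walk_inj; rewrite ?size_tuple //.
  - by rewrite size_t size_tuple.
  - by rewrite lab_t.
have Dt : D (cyc step_label t) by rewrite lab_t.
by rewrite /= st wt Dt /=; apply/eqP/val_inj.
Qed.

End Weights.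

End SolitonWalks.

(** * The Doob transform of the carrier walk *)

Section DoobTransform.
Variables (R : realType) (p : R) (K : nat) (lam : R) (h : 'cV[R]_K.+1).
Hypotheses (p01 : 0 < p < 1) (K_gt0 : (0 < K)%N).
Hypotheses (h_gt0 : forall x, 0 < h x 0) (hE : walk_mx p K *m h = lam *: h).
Implicit Types (x y : 'I_K.+1).

Lemma walk_mx_ge0 x y : 0 <= walk_mx p K x y.
Proof.
have /andP[p_gt0 p_lt1] := p01.
by rewrite mxE /walk_kernel; case: ifP => _; [|case: ifP => _]; lra.
Qed.

Lemma walk_mx_gt0 x y : carrier_step x y -> 0 < walk_mx p K x y.
Proof.
have /andP[p_gt0 p_lt1] := p01; rewrite /carrier_step mxE /walk_kernel.
by case: ifP => [_ _|_ /= ->] //; lra.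
Qed.

Lemma walk_eigenE x : \sum_y walk_mx p K x y * h y 0 = lam * h x 0.
Proof. by move/matrixP: hE => /(_ x 0); rewrite !mxE. Qed.

Lemma walk_eigenvalue_gt0 : 0 < lam.
Proof.
have : 0 < lam * h ord0 0.
  rewrite -walk_eigenE (bigD1 ord0) //= ltr_pwDl //.
    by rewrite mulr_gt0 // walk_mx_gt0 // /carrier_step /stay.
  by apply: sumr_ge0 => y _; rewrite mulr_ge0 ?walk_mx_ge0 // ltW.
by rewrite pmulr_lgt0.
Qed.

Let lam_gt0 := walk_eigenvalue_gt0.

Notation Q := (doob_kernel (walk_mx p K) lam h).

Lemma doob_ge0 x y : 0 <= Q x y.
Proof.
by rewrite /doob_kernel divr_ge0 ?mulr_ge0 ?walk_mx_ge0 // ltW.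
Qed.

Lemma doob_gt0 x y : carrier_step x y -> 0 < Q x y.
Proof.
by move=> step_xy; rewrite /doob_kernel divr_gt0 ?mulr_gt0 // walk_mx_gt0.
Qed.

Lemma doob_sum x : \sum_y Q x y = 1.
Proof.
rewrite /doob_kernel -big_distrl /= walk_eigenE divff // gt_eqF //.
by rewrite mulr_gt0.
Qed.

(** Around a cycle the sources and the targets of the transitions are the same letters, so the
    values of [h] cancel. *)
Lemma cyc_wt_doob (t : seq 'I_K.+1) :
  cyc_wt Q t = cyc_wt (walk_mx p K) t / lam ^+ size t.
Proof.
rewrite /cyc_wt /cyc !big_map /=.
have -> : \prod_(u <- zip (rotr 1 t) t) Q u.1 u.2 =
    (\prod_(u <- zip (rotr 1 t) t) walk_mx p K u.1 u.2) *
    (\prod_(u <- zip (rotr 1 t) t) h u.2 0) /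
    (lam ^+ size t * \prod_(u <- zip (rotr 1 t) t) h u.1 0).
  have -> : lam ^+ size t = \prod_(u <- zip (rotr 1 t) t) lam.
    by rewrite big_const_seq count_predT size_zip size_rotr minnn -Monoid.iteropE.
  by rewrite -!big_split -prodf_div.
have -> : \prod_(u <- zip (rotr 1 t) t) h u.1 0 = \prod_(x <- t) h x 0.
  rewrite -(big_map fst xpredT (fun x => h x 0)) -/(unzip1 _) unzip1_zip ?size_rotr //.
  by apply: perm_big; rewrite perm_rotr.
have -> : \prod_(u <- zip (rotr 1 t) t) h u.2 0 = \prod_(x <- t) h x 0.
  rewrite -(big_map snd xpredT (fun x => h x 0)) -/(unzip2 _).
  by rewrite unzip2_zip ?size_rotr.
by rewrite -mulf_div divff ?mulr1 // prodf_seq_neq0; apply/allP => x _; rewrite gt_eqF.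
Qed.

Definition reach n x y := 0 < iter n (step_op Q) (fun u => (u == y)%:R) x.

Lemma reach_step n x z y : carrier_step x z -> reach n z y -> reach n.+1 x y.
Proof.
move=> step_xz; rewrite /reach iterS => reach_zy.
rewrite -[X in 0 < X]/(\sum_u Q x u * iter n (step_op Q) (fun v => (v == y)%:R) u).
rewrite (bigD1 z) //= ltr_pwDl //; first exact: mulr_gt0 (doob_gt0 step_xz) _.
apply: sumr_ge0 => u _; apply: mulr_ge0; first exact: doob_ge0.
by apply: iter_step_ge0 => v; [exact: doob_ge0 | exact: ler0n].
Qed.

(** Walk down from x to 0, wait there for 2K - x - y steps, then climb to y. Waiting at 0 removes
    the parity obstruction and makes the length independent of x and y. *)
Lemma doob_primitive x y :
  0 < iter K.*2 (step_op Q) (fun u => (u == y)%:R) x.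
Proof.
rewrite -/(reach _ x y).
have up n : (n <= y)%N -> reach n (inord (y - n)) y.
  elim: n => [_|n IHn lt_ny].
    by rewrite /reach subn0 inord_val /= eqxx ltr01.
  apply: reach_step (IHn (ltnW lt_ny)).
  have lt_y := ltn_ord y; rewrite /carrier_step !inordK; [|by lia|by lia].
  by rewrite subnSK ?eqxx.
have wait n : reach (n + y) ord0 y.
  elim: n => [|n IHn]; first by have := up y (leqnn y); rewrite subnn;
    congr reach; apply: val_inj; rewrite /= inordK.
  by apply: reach_step IHn; rewrite /carrier_step /stay.
have down n k : (k <= K)%N -> reach (k + (n + y)) (inord k) y.
  elim: k => [_|k IHk lt_kK].
    by have := wait n; congr reach; apply: val_inj; rewrite /= inordK.
  apply: reach_step (IHk (ltnW lt_kK)).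
  by rewrite /carrier_step !inordK; lia.
have := down (K.*2 - x - y)%N x (leq_ord x); rewrite inord_val.
by congr reach; have := leq_ord x; have := leq_ord y; lia.
Qed.

(** Forbidding the stay loses mass at 0 only, while strict superharmonicity is needed at every
    state; hence v x = 1 - e^(x+1), which increases with x. If q is the probability of the step
    down, bounding v by 1 at the other targets gives A v x <= 1 - q e^x < v x once q > e. *)
Lemma cvg_stayless :
  \sum_(t : N.-tuple 'I_K.+1 | ~~ has_stay t) cyc_wt Q t @[N --> \oo] --> (0 : R).
Proof.
pose A x y := if stay x y then 0 else Q x y.
have A_ge0 x y : 0 <= A x y by rewrite /A; case: ifP => // _; exact: doob_ge0.
(* [inord x.-1] is the target of the step down when x > 0, and of the stay when x = 0. *)
have [e0 /andP[e0_gt0 e0_le1] le_e0] :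
    exists2 e : R, 0 < e <= 1 & forall x, e <= Q x (inord x.-1).
  apply: finite_lower_bound => x; apply: doob_gt0.
  have lt_x := ltn_ord x; rewrite /carrier_step /stay inordK; last by lia.
  by case: (nat_of_ord x) => [|n] /=; rewrite ?eqxx ?orbT.
(* Halving turns e0 <= q into the strict e < q, and also ensures e < 1. *)
pose e := e0 / 2.
have e_gt0 : 0 < e by rewrite divr_gt0.
have e_lt : e < e0 by rewrite /e; lra.
have e_lt1 : e < 1 by lra.
have cA : \sum_(t : N.-tuple 'I_K.+1) cyc_wt A t @[N --> \oo] --> (0 : R).
  apply: (@sum_cyc_wt_superharmonic _ _ A (fun x => 1 - e ^+ x.+1)) => //.
    by move=> x; rewrite subr_gt0 exprn_ilt1 // ltW.
  move=> x; have le_v y : 1 - e ^+ y.+1 <= 1.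
    by rewrite gerBl exprn_ge0 // ltW.
  have v_ge0 y : 0 <= 1 - e ^+ y.+1 by rewrite subr_ge0 exprn_ile1 // ltW.
  rewrite /step_op (bigD1 (inord x.-1)) //=.
  apply: le_lt_trans (_ : A x (inord x.-1) * (1 - e ^+ (inord x.-1 : 'I_K.+1).+1) +
     (1 - Q x (inord x.-1)) < _).
    have <- : \sum_(y | y != inord x.-1) Q x y = 1 - Q x (inord x.-1).
      by apply/esym/eqP; rewrite subr_eq addrC -[X in X == _](doob_sum x)
        [X in X == _](bigD1 (inord x.-1)).
    rewrite lerD2l.
    apply: ler_sum => y _; apply: (@le_trans _ _ (A x y)); first exact: ler_piMr.
    by rewrite /A; case: ifP => // _; exact: doob_ge0.
  have lt_x := ltn_ord x; have := le_e0 x.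
  rewrite /A /stay inordK; last by lia.
  case: (nat_of_ord x) lt_x => [|n] _ /=; first by rewrite expr1; lra.
  rewrite (exprS e n.+1); have : 0 < e ^+ n.+1 by rewrite exprn_gt0.
  set q := Q _ _; set a := e ^+ n.+1 => a_gt0 le_q; rewrite -subr_gt0.
  rewrite (_ : _ - _ = (q - e) * a); first by rewrite mulr_gt0 //; lra.
  by ring.
apply: squeeze_cvgr (cvg_cst 0) cA; apply: nearW => N; apply/andP; split.
  by apply: sumr_ge0 => t _; apply: cyc_wt_ge0 => x y; exact: doob_ge0.
rewrite [leRHS](bigID (fun t : N.-tuple 'I_K.+1 => ~~ has_stay t)) /=.
rewrite -[leLHS]addr0; apply: lerD; last first.
  by apply: sumr_ge0 => t _; exact: cyc_wt_ge0.
apply: ler_sum => t; rewrite /has_stay /cyc_wt /cyc has_map !big_map -all_predC.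
move=> nostay; rewrite le_eqVlt; apply/orP; left; apply/eqP.
rewrite big_seq [RHS]big_seq; apply: eq_bigr => u u_in.
by rewrite /A; move/allP: nostay => /(_ u u_in) /= /negbTE ->.
Qed.

End DoobTransform.

Lemma soliton_word_block K N (x : int -> bool) :
  bounded_solitons N K (path_encoding x) /\ 0 < path_encoding x N <->
  soliton_word K (block N x).
Proof.
rewrite (path_encoding_height _ (leqnn N)) take_oversize ?size_tuple //.
have -> : bounded_solitons N K (path_encoding x) <->
    bounded_solitons N K (fun n => height (take `|n|%N (block N x))).
  rewrite !bounded_solitonsP.
  have SE n : (n <= N)%N -> path_encoding x n%:Z = height (take n (block N x)).
    exact: path_encoding_height.
  split=> bd n le_nN; have [bd1 bd2] := bd n le_nN; split=> m le_m.
  - by rewrite -!SE ?(leq_trans le_m) //; exact: bd1.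
  - by case/andP: (le_m) => _ le_mN; rewrite -!SE //; exact: bd2.
  - by rewrite !SE ?(leq_trans le_m) //; exact: bd1.
  - by case/andP: (le_m) => _ le_mN; rewrite !SE //; exact: bd2.
rewrite /soliton_word size_tuple.
by split=> [[/asboolP -> ->]|/andP[/asboolP ? ?]].
Qed.

Lemma cvg_bounded_solitons (R : realType) (p : R) (K : nat)
    (d : measure_display) (T : measurableType d)
    (P : probability T R) (eta : int -> {RV P >-> bool})
    (dN : nat -> measure_display) (TN : forall N, measurableType (dN N))
    (PN : forall N, probability (TN N) R)
    (etaN : forall N, int -> {RV (PN N) >-> bool})
    (lam : R) (h : 'cV[R]_K.+1)
    (d' : measure_display) (T' : measurableType d')
    (P' : probability T' R) (W : int -> {RV P' >-> 'I_K.+1}) :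
  0 < p < 1 -> (0 < K)%N -> iid_bernoulli p eta ->
  (forall N : nat, (0 < N)%N ->
    has_conditional_law (PN N) (fun w => block N (fun n => etaN N n w))
      P (fun w => block N (fun n => eta n w))
      [set w | bounded_solitons N K (path_encoding (fun n => eta n w)) /\
        0 < path_encoding (fun n => eta n w) N] /\
    forall w, cyclic N (fun n => etaN N n w)) ->
  walk_mx p K *m h = lam *: h -> (forall x, 0 < h x 0) ->
  stationary_markov_chain P' (doob_kernel (walk_mx p K) lam h)
    (soliton_measure p h) (fun n => W n) ->
  cvg_in_distribution PN (fun N => config (fun n => etaN N n))
    P' (config (carrier_config (fun n => W n))).
Proof.
move=> p01 K_gt0 iid law hE h_gt0 mc; have [invpi _ _] := mc.
have mX n b : measurable (eta n @^-1` [set b]) by exact: measurable_rv_fiber.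
have mXN N n b : measurable (etaN N n @^-1` [set b]).
  exact: measurable_rv_fiber.
have mW n x : measurable (W n @^-1` [set x]) by exact: measurable_rv_fiber.
have lam_gt0 := walk_eigenvalue_gt0 p01 h_gt0 hE.
apply: (@cvg_cyclic_configuration R _ (doob_kernel (walk_mx p K) lam h)
  (soliton_measure p h) K.*2 (@step_label K) _ _ _ _ _ dN TN PN
  (fun N n => etaN N n : TN N -> bool) d' T' P' _
  (fun n => W n : T' -> 'I_K.+1)
  (fun N (t : N.-tuple 'I_K.+1) => has_stay t)) => //.
- exact: doob_ge0.
- exact: doob_sum.
- by rewrite double_gt0.
- exact: doob_primitive.
- by move=> a M z; exact: markov_window.
- exact: cvg_stayless.
move=> N N_gt0; have [lawN cycN] := law N N_gt0; split=> // B.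
have sumE (D : pred (seq bool)) :
    \sum_(b : N.-tuple bool | soliton_word K b && D b) \prod_(k <- b) bit_wt p k =
    lam ^+ N * \sum_(t : N.-tuple 'I_K.+1 | has_stay t && D (cyc (@step_label K) t))
      cyc_wt (doob_kernel (walk_mx p K) lam h) t.
  rewrite sum_soliton_words // big_distrr; apply: eq_bigr => t _ /=.
  rewrite cyc_wt_doob // size_tuple mulrCA divff ?mulr1 //.
  by rewrite expf_neq0 // gt_eqF.
have -> := (@conditional_law_block _ _ _ _ _ _ _ (fun n => eta n : T -> bool)
  (fun n => etaN N n : TN N -> bool) N (soliton_word K) _
  (fun b => \prod_(k <- b) bit_wt p k) mX (mXN N) _ _ lawN B).
- rewrite sumE; have := sumE xpredT.
  under eq_bigl do rewrite andbT.
  move=> ->; rewrite -mulf_div divff ?mul1r //; last by rewrite expf_neq0 // gt_eqF.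
  by congr (_ / _); apply: eq_bigl => t; rewrite andbT.
- by move=> w; exact: soliton_word_block.
by move=> z; exact: iid_window.
Qed.

Theorem proposition2p14 (R : realType) :
  (* (a) *)
  (forall (p : R) (d : measure_display) (T : measurableType d)
      (P : probability T R) (eta : int -> {RV P >-> bool})
      (dN : nat -> measure_display) (TN : forall N, measurableType (dN N))
      (PN : forall N, probability (TN N) R)
      (etaN : forall N, int -> {RV (PN N) >-> bool}),
    let S w := path_encoding (fun n => eta n w) in
    0 < p < 2^-1 ->
    iid_bernoulli p eta ->
    (forall N : nat, (0 < N)%N ->
      has_conditional_law (PN N) (fun w => block N (fun n => etaN N n w))
        P (fun w => block N (fun n => eta n w)) [set w | 0 < S w N] /\
      forall w, cyclic N (fun n => etaN N n w)) ->
    cvg_in_distribution PN (fun N => config (fun n => etaN N n))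
      P (config (fun n => eta n)))
  /\
  (* (b) *)
  (forall (p0 p1 : R) (nu : bool -> R)
      (d : measure_display) (T : measurableType d)
      (P : probability T R) (eta : int -> {RV P >-> bool})
      (dN : nat -> measure_display) (TN : forall N, measurableType (dN N))
      (PN : forall N, probability (TN N) R)
      (etaN : forall N, int -> {RV (PN N) >-> bool}),
    let S w := path_encoding (fun n => eta n w) in
    0 < p0 < 1 -> 0 < p1 < 1 -> p0 + p1 < 1 ->
    stationary_markov_chain P (two_state_kernel p0 p1) nu (fun n => eta n) ->
    (forall N : nat, (0 < N)%N ->
      let A := [set w | eta N w = eta 0 w /\ 0 < S w N] in
      (forall F : N.-tuple bool -> R,
        ('E_(PN N)[fun w => F (block N (fun n => etaN N n w))] =
          (cond_expect P
             (fun w => (nu (eta 0 w))^-1 * F (block N (fun n => eta n w))) A /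
           cond_expect P (fun w => (nu (eta 0 w))^-1) A)%:E)%E) /\
      forall w, cyclic N (fun n => etaN N n w)) ->
    cvg_in_distribution PN (fun N => config (fun n => etaN N n))
      P (config (fun n => eta n)))
  /\
  (* (c) *)
  (forall (p : R) (K : nat)
      (d : measure_display) (T : measurableType d)
      (P : probability T R) (eta : int -> {RV P >-> bool})
      (dN : nat -> measure_display) (TN : forall N, measurableType (dN N))
      (PN : forall N, probability (TN N) R)
      (etaN : forall N, int -> {RV (PN N) >-> bool})
      (lam : R) (h : 'cV[R]_K.+1)
      (d' : measure_display) (T' : measurableType d')
      (P' : probability T' R) (W : int -> {RV P' >-> 'I_K.+1}),
    let S w := path_encoding (fun n => eta n w) in
    0 < p < 1 -> (0 < K)%N ->
    iid_bernoulli p eta ->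
    (forall N : nat, (0 < N)%N ->
      has_conditional_law (PN N) (fun w => block N (fun n => etaN N n w))
        P (fun w => block N (fun n => eta n w))
        [set w | bounded_solitons N K (S w) /\ 0 < S w N] /\
      forall w, cyclic N (fun n => etaN N n w)) ->
    perron_frobenius (walk_mx p K) lam h ->
    stationary_markov_chain P' (doob_kernel (walk_mx p K) lam h)
      (soliton_measure p h) (fun n => W n) ->
    cvg_in_distribution PN (fun N => config (fun n => etaN N n))
      P' (config (carrier_config (fun n => W n)))).
Proof.
split; last split.
- move=> p d T P eta dN TN PN etaN S p_lt iid law.
  exact: cvg_iid p_lt iid law.
- move=> p0 p1 nu d T P eta dN TN PN etaN S p0_01 p1_01 p01 mc law.
  exact: cvg_markov p0_01 p1_01 p01 mc law.
move=> p K d T P eta dN TN PN etaN lam h d' T' P' W S p01 K_gt0 iid law [hE h_gt0 _].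
exact: cvg_bounded_solitons p01 K_gt0 iid law hE h_gt0.
Qed.
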